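(* Let $d\in\mathbb Z_{>0}$, put $(L,r)=(d/2,1)$ if $d$ is even and $(L,r)=(d,2)$ if $d$ is odd, and let $(H_1,\dots,H_d)$ be a sequence of matrices $H_n\in{\rm Sym}_2(\mathbb R)\cap{\rm SL}_2(\mathbb R)$. Define a locally constant matrix-valued function $H(t)$ on $[0,L)$ by $H(t)=H_n$ for $r(n-1)/2\le t<rn/2$ $(1\le n\le d)$. Then the quasi-canonical system $$-\frac{d}{dt}\begin{bmatrix}A(t,z)\\ B(t,z)\end{bmatrix}=z\begin{bmatrix}0&-1\\ 1&0\end{bmatrix}H(t)\begin{bmatrix}A(t,z)\\ B(t,z)\end{bmatrix}\quad(z\in\mathbb C)$$ on $[0,L)$ together with the boundary condition $$\lim_{t\to L}\begin{bmatrix}A(t,z)\\ B(t,z)\end{bmatrix}=\begin{bmatrix}A\\ B\end{bmatrix}\neq0\quad(A,B\in\mathbb R)$$ has a unique solution ${}^{\rm t}[A(t,z)\ B(t,z)]$, and its components have the form $$A(t,z)=\frac12\sum_{j=0}^{d-n}\Bigl[a_n(L-rj)e^{i(L-rj-t)z}+\overline{a_n(L-rj)}e^{-i(L-rj-t)z}\Bigr],$$ $$B(t,z)=\frac12\sum_{j=0}^{d-n}\Bigl[b_n(L-rj)e^{i(L-rj-t)z}+\overline{b_n(L-rj)}e^{-i(L-rj-t)z}\Bigr]$$ for $r(n-1)/2\le t<rn/2$, $1\le n\le d$, with complex numbers $a_n(k),b_n(k)$. Therefore, for $r(n-1)/2\le t<rn/2$, $E(t,z):=A(t,z)-iB(t,z)$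 is the exponential polynomial $$E(t,z)=\frac12\sum_{j=0}^{d-n}\Bigl[(a_n(L-rj)-ib_n(L-rj))e^{i(L-rj-t)z}+\overline{(a_n(L-rj)+ib_n(L-rj))}\,e^{-i(L-rj-t)z}\Bigr].$$ Moreover, $E(t,0)=A-iB$ and $E(t,z)$ has no real zeros (in $z$) for any fixed $0\le t\le L$. In particular, if $H_n>0$ (positive definite) for all $n$, then $E(0,z)=A(0,z)-iB(0,z)$ belongs to $\mathbb{HB}$.
   Context: ${\rm Sym}_2(\mathbb R)$ is the set of real symmetric $2\times2$ matrices. A solution of the system consists of functions absolutely continuous in $t$ that satisfy the equation for almost every $t$, for every fixed $z\in\mathbb C$. At $t=L$ values mean the limits as $t\to L$. $\mathbb{HB}$ (Hermite--Biehler class) is the set of entire functions $E$ with no real zeros such that $|E^\sharp(z)|<|E(z)|$ for all $z$ with $\Im z>0$, where $E^\sharp(z)=\overline{E(\bar z)}$. *)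

(* Defs.v *)
From HB Require Import structures.
From mathcomp Require Import all_boot all_order all_algebra.
From mathcomp Require Import all_classical all_reals all_analysis.
From mathcomp Require Import complex.

Set Implicit Arguments.
Unset Strict Implicit.
Unset Printing Implicit Defensive.

Import Order.TTheory GRing.Theory Num.Theory.
Import numFieldNormedType.Exports.

Local Open Scope classical_set_scope.
Local Open Scope ring_scope.
Local Open Scope complex_scope.

(* [R[i]] gets its topology and its structure of normed module over itself
   through the alias [R[i]^o]. *)

Definition cexp {R : realType} (z : R[i]) : R[i] :=
  (expR (complex.Re z))%:C * (cos (complex.Im z) +i* sin (complex.Im z)).

(* [f'(t) = l] for a complex-valued function of a real variable; [derive] does
   not apply, since [R[i]] is not a normed module over [R] in the library. *)
Definition has_deriv {R : realType} (f : R -> R[i]^o) (t : R) (l : R[i]^o) :=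
  (h^-1)%:C * (f (t + h) - f t) @[h --> (0 : R)^'] --> l.

Definition abs_continuous {R : realType} (D : set R) (f : R -> R[i]) :=
  forall eps : R, 0 < eps -> exists2 delta : R, 0 < delta &
    forall (n : nat) (a b : 'I_n -> R),
      (forall i, [/\ D (a i), D (b i) & a i <= b i]) ->
      trivIset setT (fun i => `]a i, b i[%classic) ->
      \sum_(i < n) (b i - a i) < delta ->
      \sum_(i < n) `|f (b i) - f (a i)| < eps%:C.

Definition entire {R : realType} (f : R[i] -> R[i]) :=
  forall z : R[i]^o, derivable (f : R[i]^o -> R[i]^o) z 1.

Definition sharp {R : realType} (f : R[i] -> R[i]) (z : R[i]) : R[i] :=
  (f (z^*))^*.

Definition hermite_biehler {R : realType} (E : R[i] -> R[i]) :=
  [/\ entire E,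
      forall x : R, E x%:C <> 0 &
      forall z : R[i], 0 < complex.Im z -> `|sharp E z| < `|E z|].

Definition posdefmx {R : realType} n (M : 'M[R]_n) :=
  forall v : 'cV[R]_n, v != 0 -> 0 < (v^T *m M *m v) 0 0.

(* The pair [(L, r)]; in both cases [L = r * d / 2]. *)
Definition sysL (d : nat) : nat := if odd d then d else d./2.
Definition sysr (d : nat) : nat := if odd d then 2 else 1.

(* [n] is numbered from 1. *)
Definition in_step {R : realType} (d n : nat) (t : R) : bool :=
  (sysr d)%:R * (n%:R - 1) / 2 <= t < (sysr d)%:R * n%:R / 2.

(* The steps are disjoint and cover [0, L), so that at most one term is left. *)
Definition hamiltonian {R : realType} (d : nat) (H : nat -> 'M[R]_2) (t : R) :
    'M[R]_2 :=
  \sum_(1 <= n < d.+1 | in_step d n t) H n.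

Definition col2 {T : Type} (x y : T) : 'cV[T]_2 :=
  \col_(i < 2) (if i == 0 then x else y).

(* [[0, -1], [1, 0]] *)
Definition sympl {T : pzRingType} : 'M[T]_2 :=
  \matrix_(i < 2, j < 2) ((j < i)%N%:R - (i < j)%N%:R).

Definition quasi_canonical_solution {R : realType} (L : R) (H : R -> 'M[R]_2)
    (A0 B0 : R) (A B : R -> R[i] -> R[i]) :=
  forall z : R[i],
  [/\ abs_continuous `[0, L[ (A^~ z) /\ abs_continuous `[0, L[ (B^~ z),
      {ae (@lebesgue_measure R), forall t : R, 0 <= t < L ->
        exists dY : 'cV[R[i]]_2,
        [/\ has_deriv (A^~ z) t (dY 0 0),
            has_deriv (B^~ z) t (dY 1 0) &
            - dY = z *: (sympl *m map_mx (real_complex R) (H t)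
                           *m col2 (A t z) (B t z))]} &
      ((A t z : R[i]^o) @[t --> L^'-] --> (A0%:C : R[i]^o)) /\
      ((B t z : R[i]^o) @[t --> L^'-] --> (B0%:C : R[i]^o))].

(* A function on [0, L) extended to [t = L] by its limit there. *)
Definition extend_lim {R : realType} (L : R) (f : R -> R[i]^o) (t : R) :
    R[i]^o :=
  if t < L then f t else lim (f s @[s --> L^'-]).

(* [1/2 * sum_(j = 0)^(d - n) [p_j e^(i(L-rj-t)z) + q_j e^(-i(L-rj-t)z)]], where
   [p_j] and [q_j] are [p k] and [q k] at the integer [k = L - rj]. *)
Definition exp_sum {R : realType} (d n : nat) (p q : int -> R[i]) (t : R)
    (z : R[i]) : R[i] :=
  2^-1 * \sum_(0 <= j < (d - n).+1)
    let k : int := (sysL d)%:Z - (sysr d * j)%:Z in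
    let w : R[i] := 'i%C * (k%:~R - t)%:C * z in
    (p k * cexp w + q k * cexp (- w)).

(* Main.v *)
Require Import Defs.
From HB Require Import structures.
From mathcomp Require Import all_boot all_order all_algebra.
From mathcomp Require Import all_classical all_reals all_analysis.
From mathcomp Require Import complex.
From mathcomp Require Import zify ring lra.

Set Implicit Arguments.
Unset Strict Implicit.
Unset Printing Implicit Defensive.

Import Order.TTheory GRing.Theory Num.Theory.
Import numFieldNormedType.Exports.

Local Open Scope classical_set_scope.
Local Open Scope ring_scope.
Local Open Scope complex_scope.

(** On step [n] the matrix [M = J H_n] of the system, where [J = [[0, -1], [1, 0]]],
    has trace 0 and determinant 1, so that [M^2 = -1]: the system
    [Y' = - z M Y] is solved by [Y(t) = (cos (z (s - t)) + sin (z (s - t)) M) Y(s)].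
    Composing these flows from [L] backwards gives the solution ([solution]), which
    is Lipschitz in [t], hence absolutely continuous, and satisfies the equation
    except at the ends of the steps ([solution_solves]).

    Uniqueness rests on the bound [ac_increment] for the increment of an absolutely
    continuous function whose derivative is bounded almost everywhere, which is
    proved by covering the exceptional null set by an open set of small measure and
    applying Cousin's lemma ([cousin]). A Gronwall argument going back from [L]
    ([backward_gronwall]) then makes the difference of two solutions vanish.

    For the exponential form, write the flow as [e^(i w) P + e^(-i w) conj P] with
    [P = (1 - i M) / 2]. Going back across the left end [s] of a step, the first
    factor preserves the frequencies [k = L - r j], and the second one reflects them
    to [2 s - k], which are again of this form with one new value of [j]
    ([flow_conj_exp_sum], [step_coefficients]).

    At [z = 0] all flows are the identity. For real [z] they are real and invertible,
    so that [A] and [B] are real and do not vanish together, and [A - i B] is not 0.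
    For [Im z > 0] and positive definite [H_n], going back in time strictly increases
    the form [Im (conj A * B)] ([wronskian_flow_gt0]), which is 0 at [L]; as [A] and [B]
    are real entire functions of [z] at [t = 0], its positivity there is the
    inequality [|E^sharp(z)| < |E(z)|]. *)

(** * The real-valued modulus of complex numbers *)

(** The modulus as an element of [R]: the library norm of [R[i]] lives in [R[i]],
    where the order is only partial and linear arithmetic does not apply. *)
Definition cmod {R : realType} (z : R[i]) : R := Normc.normc z.

Lemma normE (R : realType) (z : R[i]) : `|z| = (cmod z)%:C.
Proof. by []. Qed.

Lemma cmodM (R : realType) (z w : R[i]) : cmod (z * w) = cmod z * cmod w.
Proof. exact: Normc.normcM. Qed.

Lemma cmodD (R : realType) (z w : R[i]) : cmod (z + w) <= cmod z + cmod w.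
Proof. exact: le_normcD. Qed.

Lemma cmodN (R : realType) (z : R[i]) : cmod (- z) = cmod z.
Proof. exact: normcN. Qed.

Lemma cmod0 (R : realType) : cmod (0 : R[i]) = 0.
Proof. exact: Normc.normc0. Qed.

Lemma cmod_real (R : realType) (x : R) : cmod x%:C = `|x|.
Proof. by rewrite /cmod /= expr0n /= addr0 sqrtr_sqr. Qed.

Lemma cmod_i (R : realType) : cmod ('i%C : R[i]) = 1.
Proof. by rewrite /cmod /= expr0n /= add0r expr1n sqrtr1. Qed.

Lemma cmod_ge0 (R : realType) (z : R[i]) : 0 <= cmod z.
Proof. by case: z => a b; exact: sqrtr_ge0. Qed.

Lemma cmod_eq0 (R : realType) (z : R[i]) : cmod z = 0 -> z = 0.
Proof. exact: Normc.eq0_normc. Qed.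

Lemma cmod_distC (R : realType) (z w : R[i]) : cmod (z - w) = cmod (w - z).
Proof. by rewrite -cmodN opprB. Qed.

Lemma cmodB (R : realType) (z w : R[i]) : cmod (z - w) <= cmod z + cmod w.
Proof. by rewrite -(cmodN w); exact: cmodD. Qed.

Lemma cmod_le_ReIm (R : realType) (z : R[i]) :
  cmod z <= `|complex.Re z| + `|complex.Im z|.
Proof.
rewrite {1}(complexE z) (le_trans (cmodD _ _)) // cmodM cmod_i mul1r.
by rewrite !cmod_real.
Qed.

Lemma ReIm_le_cmod (R : realType) (z : R[i]) :
  `|complex.Re z| <= cmod z /\ `|complex.Im z| <= cmod z.
Proof.
case: z => a b; rewrite /cmod /= -![`|_|]sqrtr_sqr; split;
by rewrite ler_wsqrtr // ?lerDl ?lerDr sqr_ge0.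
Qed.

Lemma cmod_lt (R : realType) (z w : R[i]) : (`|z| < `|w|) = (cmod z < cmod w).
Proof. by rewrite !normE ltcR. Qed.

Lemma cmod_sqr (R : realType) (z : R[i]) :
  cmod z ^+ 2 = complex.Re z ^+ 2 + complex.Im z ^+ 2.
Proof. by case: z => a b; rewrite /cmod /= sqr_sqrtr // addr_ge0 ?sqr_ge0. Qed.

(** * The complex exponential *)

Lemma cexp0 (R : realType) : cexp (0 : R[i]) = 1.
Proof.
by rewrite /cexp /= expR0 cos0 sin0 mul1r.
Qed.

Lemma cexpD (R : realType) (z w : R[i]) : cexp (z + w) = cexp z * cexp w.
Proof.
case: z w => [a b] [c e]; rewrite /cexp /= expRD cosD sinD.
by apply/eqP; rewrite eq_complex /=; apply/andP; split; apply/eqP; ring.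
Qed.

Lemma cexpN (R : realType) (z : R[i]) : cexp z * cexp (- z) = 1.
Proof. by rewrite -cexpD subrr cexp0. Qed.

Lemma cexp_conj (R : realType) (z : R[i]) : (cexp z)^* = cexp (z^*).
Proof.
case: z => a b; rewrite /cexp /= cosN sinN.
by apply/eqP; rewrite eq_complex /=; apply/andP; split; apply/eqP; ring.
Qed.

Lemma cmod_cexp (R : realType) (z : R[i]) : cmod (cexp z) = expR (complex.Re z).
Proof.
rewrite /cexp cmodM cmod_real ger0_norm ?expR_ge0 //.
by rewrite /cmod /= cos2Dsin2 sqrtr1 mulr1.
Qed.

Lemma derive_slope (R : realType) (f : R -> R) (l eps : R) :
  is_derive (0 : R) 1 f l -> 0 < eps ->
  exists2 delta : R, 0 < delta &
    forall h, `|h| < delta -> `|f h - f 0 - l * h| <= eps * `|h|.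
Proof.
move=> [df dl] eps0.
have : h^-1 *: ((f \o shift 0) (h *: 1) - f 0) @[h --> 0^'] --> l.
  by rewrite -dl; exact: df.
move/cvgrPdist_lt => /(_ _ eps0).
rewrite near_withinE => /nbhs_ballP[delta /= delta0 H].
exists delta => // h hd; have [->|h0] := eqVneq h 0.
  by rewrite subrr sub0r mulr0 oppr0 normr0 mulr0.
have /= := H h; rewrite /ball /= sub0r normrN => /(_ hd h0).
rewrite addr0 /GRing.scale /= mulr1 => /ltW H1.
have -> : f h - f 0 - l * h = - h * (l - h^-1 * (f h - f 0)).
  by field.
by rewrite normrM normrN mulrC ler_wpM2r.
Qed.

(** Complex differentiability of the exponential at 0. Every other derivative of
    an exponential below, complex or along the real line, comes from this estimate
    and [cexpD]. *)
Lemma cexp_near0 (R : realType) (eps : R) : 0 < eps ->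
  exists2 delta : R, 0 < delta &
    forall w : R[i], cmod w < delta -> cmod (cexp w - 1 - w) <= eps * cmod w.
Proof.
(* The real part of the error is at most [e |x| + 3 e |y|] and the imaginary part at
   most [3 e |y| + 2 |x| |y|]; with [|x| < e] they add up to at most [9 e |w|]. *)
move=> eps0; have [e e0 [e1 ee]] : exists2 e : R, 0 < e & e <= 1 /\ 9 * e <= eps.
  exists (Num.min 1 (eps / 9)); first by rewrite lt_min ltr01 divr_gt0.
  split; first by rewrite ge_min lexx.
  have : Num.min 1 (eps / 9) <= eps / 9 by rewrite ge_min lexx orbT.
  by lra.
have [d1 d10 H1] := derive_slope (is_derive_expR (0 : R)) e0.
have [d2 d20 H2] := derive_slope (is_derive_cos (0 : R)) e0.
have [d3 d30 H3] := derive_slope (is_derive_sin (0 : R)) e0.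
exists (Num.min e (Num.min d1 (Num.min d2 d3))).
  by rewrite !lt_min e0 d10 d20 d30.
move=> [x y]; set n := cmod _; rewrite !lt_min => /and4P[ne n1 n2 n3].
have [xn yn] : `|x| <= n /\ `|y| <= n by exact: (ReIm_le_cmod (x +i* y)).
have n0 : 0 <= n := cmod_ge0 _.
have {H1} := H1 _ (le_lt_trans xn n1).
have {H2} := H2 _ (le_lt_trans yn n2).
have {H3} := H3 _ (le_lt_trans yn n3).
rewrite expR0 cos0 sin0 oppr0 mul0r !subr0 addr0 !mul1r => hs hc hx.
have ax0 := normr_ge0 x; have ay0 := normr_ge0 y.
have hx1 : `|expR x - 1| <= 2 * `|x|.
  have -> : expR x - 1 = (expR x - 1 - x) + x by ring.
  by rewrite (le_trans (ler_normD _ _)) //; nra.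
have hx3 : `|expR x| <= 3.
  have -> : expR x = (expR x - 1) + 1 by ring.
  by rewrite (le_trans (ler_normD _ _)) // normr1; lra.
rewrite (le_trans (cmod_le_ReIm _)) // /cexp /=.
have -> : expR x * cos y - 0 * sin y - 1 - x =
  expR x * (cos y - 1) + (expR x - 1 - x) by ring.
have -> : expR x * sin y + 0 * cos y - 0 - y =
  expR x * (sin y - y) + (expR x - 1) * y by ring.
have := ler_normD (expR x * (cos y - 1)) (expR x - 1 - x).
have := ler_normD (expR x * (sin y - y)) ((expR x - 1) * y).
rewrite !normrM.
have p1 : `|expR x| * `|cos y - 1| <= 3 * (e * n).
  by apply: ler_pM => //; apply: (le_trans hc); rewrite ler_wpM2l // ltW.
have p2 : `|expR x| * `|sin y - y| <= 3 * (e * n).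
  by apply: ler_pM => //; apply: (le_trans hs); rewrite ler_wpM2l // ltW.
have p3 : `|expR x - 1| * `|y| <= (2 * e) * n.
  by apply: ler_pM => //; lra.
have p4 : e * `|x| <= e * n by rewrite ler_wpM2l // ltW.
have p5 : 9 * e * n <= eps * n by rewrite ler_wpM2r.
by move=> q1 q2; lra.
Qed.

(** * Derivatives along the real line *)

(** Multiplying by [h] turns the limit of quotients into a first-order expansion
    with an error controlled by [eps * `|h|]; in this form [h = 0] is harmless and
    the estimates add up. *)
Lemma has_derivP (R : realType) (f : R -> R[i]) (t : R) (l : R[i]) :
  has_deriv f t l <-> forall eps : R, 0 < eps -> exists2 delta : R, 0 < delta &
    forall h, `|h| < delta -> cmod (f (t + h) - f t - h%:C * l) <= eps * `|h|.
Proof.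
have key (h : R) : h != 0 ->
    cmod (f (t + h) - f t - h%:C * l) =
    `|h| * cmod (l - (h^-1)%:C * (f (t + h) - f t)).
  move=> h0; rewrite -(cmod_real h) -cmodM -cmodN; congr cmod.
  rewrite opprB mulrBr mulrA -rmorphM /= divff // mul1r.
  by ring.
split.
  move=> /(@cvgrPdist_lt (R[i]) (R[i]^o)) H eps eps0; have := H eps%:C.
  rewrite ltcR => /(_ eps0); rewrite near_withinE => /nbhs_ballP[delta /= delta0 {}H].
  exists delta => // h hd; have [->|h0] := eqVneq h 0.
    by rewrite addr0 mul0r !subrr cmod0 normr0 mulr0.
  have := H h; rewrite /ball /= sub0r normrN => /(_ hd h0).
  rewrite normE ltcR => /ltW H1.
  by rewrite key // mulrC ler_wpM2r.
move=> H; apply/(@cvgrPdist_lt (R[i]) (R[i]^o)) => -[e e'].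
rewrite ltcE /= => /andP[/eqP -> e0].
have e20 : 0 < e / 2 by rewrite divr_gt0.
have [delta delta0 {}H] := H _ e20.
rewrite near_withinE; apply/nbhs_ballP; exists delta => //= h.
rewrite /ball /= sub0r normrN => hd h0.
rewrite normE ltcR.
have := H h hd; rewrite key // mulrC ler_pM2r ?normr_gt0 //.
by move=> H1; lra.
Qed.

Lemma has_deriv_ext (R : realType) (f g : R -> R[i]) (t delta : R) (l : R[i]) :
  0 < delta -> (forall u, `|u - t| < delta -> g u = f u) ->
  has_deriv f t l -> has_deriv g t l.
Proof.
move=> delta0 fg /has_derivP H; apply/has_derivP => eps /H[d d0 {}H].
exists (Num.min d delta); first by rewrite lt_min d0.
move=> h; rewrite lt_min => /andP[hd hdelta]; rewrite !fg //.
- exact: H.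
- by rewrite subrr normr0.
- by rewrite addrC addKr.
Qed.

Lemma has_derivD (R : realType) (f g : R -> R[i]) (t : R) (l m : R[i]) :
  has_deriv f t l -> has_deriv g t m ->
  has_deriv (fun u => f u + g u) t (l + m).
Proof.
move=> /has_derivP Hf /has_derivP Hg; apply/has_derivP => eps eps0.
have e2 : 0 < eps / 2 by rewrite divr_gt0.
have [d d0 {}Hf] := Hf _ e2; have [d' d'0 {}Hg] := Hg _ e2.
exists (Num.min d d'); first by rewrite lt_min d0.
move=> h; rewrite lt_min => /andP[/Hf h1 /Hg h2].
have -> : f (t + h) + g (t + h) - (f t + g t) - h%:C * (l + m) =
  (f (t + h) - f t - h%:C * l) + (g (t + h) - g t - h%:C * m) by ring.
by rewrite (le_trans (cmodD _ _)) //; lra.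
Qed.

Lemma has_derivZ (R : realType) (f : R -> R[i]) (t : R) (k l : R[i]) :
  has_deriv f t l -> has_deriv (fun u => k * f u) t (k * l).
Proof.
move=> /has_derivP Hf; apply/has_derivP => eps eps0.
have k0 := cmod_ge0 k; have k1 : 0 < cmod k + 1 by lra.
have e2 : 0 < eps / (cmod k + 1) by rewrite divr_gt0.
have [d d0 {}Hf] := Hf _ e2; exists d => // h /Hf.
rewrite mulrAC ler_pdivlMr // => H.
have -> : k * f (t + h) - k * f t - h%:C * (k * l) =
   k * (f (t + h) - f t - h%:C * l) by ring.
have := cmod_ge0 (f (t + h) - f t - h%:C * l).
by rewrite cmodM; lra.
Qed.

Lemma has_derivB (R : realType) (f g : R -> R[i]) (t : R) (l m : R[i]) :
  has_deriv f t l -> has_deriv g t m ->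
  has_deriv (fun u => f u - g u) t (l - m).
Proof.
move=> Hf Hg; have := has_derivD Hf (has_derivZ (k := -1) Hg).
rewrite mulN1r; apply: (has_deriv_ext ltr01) => u _.
by rewrite mulN1r.
Qed.

Lemma has_deriv_cexp (R : realType) (c : R[i]) (s t : R) :
  has_deriv (fun u => cexp (c * (s - u)%:C)) t (- c * cexp (c * (s - t)%:C)).
Proof.
apply/has_derivP => eps eps0.
pose e := cexp (c * (s - t)%:C).
have c0 := cmod_ge0 c; have c1 : 0 < cmod c + 1 by lra.
have e0 := cmod_ge0 e; have e1 : 0 < cmod e + 1 by lra.
have e2 : 0 < eps / (cmod e + 1) / (cmod c + 1) by rewrite !divr_gt0.
have [d d0 H] := cexp_near0 e2.
exists (d / (cmod c + 1)); first by rewrite divr_gt0.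
move=> h; rewrite ltr_pdivlMr // => hd.
have h0 := normr_ge0 h.
have wE : cmod (- c * h%:C) = cmod c * `|h| by rewrite cmodM cmodN cmod_real.
have := H (- c * h%:C); rewrite wE => /(_ ltac:(lra)) {}H.
have -> : c * (s - (t + h))%:C = c * (s - t)%:C + (- c * h%:C).
  by rewrite !rmorphB rmorphD /=; ring.
rewrite cexpD -/e.
have -> : e * cexp (- c * h%:C) - e - h%:C * (- c * e) =
  e * (cexp (- c * h%:C) - 1 - (- c * h%:C)) by ring.
rewrite cmodM.
have {H} : cmod (cexp (- c * h%:C) - 1 - - c * h%:C) <= eps / (cmod e + 1) * `|h|.
  apply: (le_trans H); rewrite mulrA ler_wpM2r //.
  rewrite mulrAC ler_pdivrMr // ler_wpM2l ?divr_ge0 ?ltW //.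
  by lra.
rewrite mulrAC ler_pdivlMr // => H.
have := cmod_ge0 (cexp (- c * h%:C) - 1 - - c * h%:C).
by lra.
Qed.

(** * Entire functions *)

Lemma entire_cst (R : realType) (k : R[i]) : entire (fun=> k).
Proof. by move=> z; exact: derivable_cst. Qed.

Lemma entireD (R : realType) (f g : R[i] -> R[i]) :
  entire f -> entire g -> entire (fun z => f z + g z).
Proof. by move=> Hf Hg z; exact: derivableD. Qed.

Lemma entireM (R : realType) (f g : R[i] -> R[i]) :
  entire f -> entire g -> entire (fun z => f z * g z).
Proof. by move=> Hf Hg z; exact: derivableM. Qed.

Lemma entire_cexp (R : realType) (c : R[i]) : entire (fun z => cexp (c * z)).
Proof.
move=> z; rewrite /derivable.
apply/cvg_ex; exists (c * cexp (c * z) : R[i]^o).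
apply/(@cvgrPdist_lt (R[i]) (R[i]^o)) => -[e e'].
rewrite ltcE /= => /andP[/eqP -> eps0] {e'}; rewrite -[_ +i* _]/e%:C.
pose k := cexp (c * z).
have c0 := cmod_ge0 c; have c1 : 0 < cmod c + 1 by lra.
have k0 := cmod_ge0 k; have k1 : 0 < cmod k + 1 by lra.
have e2 : 0 < e / (cmod k + 1) / (cmod c + 1) by rewrite !divr_gt0.
have [d d0 H] := cexp_near0 e2.
rewrite near_withinE; apply/nbhs_ballP; exists (d / (cmod c + 1))%:C => /=.
  by rewrite ltcR divr_gt0.
move=> h; rewrite /ball /= sub0r normrN normE ltcR ltr_pdivlMr // => hd h0.
have ch0 := cmod_ge0 h.
have := H (c * h); rewrite cmodM => /(_ ltac:(lra)) {}H.
rewrite normE ltcR /GRing.scale /=.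
have -> : cexp (c * (h * 1 + z)) = cexp (c * h) * k by rewrite mulr1 mulrDr cexpD.
rewrite -/k.
have -> : c * k - h^-1 * (cexp (c * h) * k - k) =
  - k * h^-1 * (cexp (c * h) - 1 - c * h) by field.
rewrite !cmodM cmodN /cmod Normc.normcV -/(cmod k) -/(cmod h).
have ch : 0 < cmod h.
  rewrite lt_neqAle ch0 andbT eq_sym; apply/eqP => /cmod_eq0 hz.
  by move: h0; rewrite hz eqxx.
rewrite mulrAC ltr_pdivrMr //.
rewrite -/(cmod (cexp (c * h) - 1 - c * h)).
set m := cmod (cexp (c * h) - 1 - c * h) in H *.
have m0 : 0 <= m := cmod_ge0 _.
have {H} : m <= e / (cmod k + 1) * cmod h * (cmod c / (cmod c + 1)).
  by apply: (le_trans H); rewrite le_eqVlt; apply/orP; left; apply/eqP; field; lra.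
have : cmod c / (cmod c + 1) < 1 by rewrite ltr_pdivrMr //; lra.
have : 0 <= cmod c / (cmod c + 1) by rewrite divr_ge0 // ltW.
set q := cmod c / _ => q0 q1 H.
have H1 : m < e / (cmod k + 1) * cmod h.
  apply: (le_lt_trans H); rewrite gtr_pMr // mulr_gt0 // divr_gt0 //.
have H2 : m * (cmod k + 1) < e * cmod h by move: H1; rewrite mulrAC ltr_pdivlMr.
by lra.
Qed.

(** * Increments of absolutely continuous functions *)

(** Cousin's lemma in relational form: a property of intervals that is stable under
    concatenation and holds for all short intervals around each point holds for
    [[a, b]]. The supremum of the points reachable from [a] is reached, by the local
    property there, and can be passed unless it is [b]. *)
Lemma cousin (R : realType) (P : R -> R -> Prop) (a b : R) : a <= b ->
  (forall x y z, a <= x -> x <= y -> y <= z -> z <= b ->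
    P x y -> P y z -> P x z) ->
  (forall t, a <= t <= b -> exists2 delta : R, 0 < delta &
    forall x y, a <= x -> x <= t -> t <= y -> y <= b ->
      t - delta < x -> y < t + delta -> P x y) ->
  P a b.
Proof.
move=> ab Ptrans Ploc; pose S := [set x | a <= x <= b /\ P a x].
have Sa : S a.
  have [|d d0 H] := Ploc a; first by rewrite lexx ab.
  by split; [rewrite lexx ab|apply: H => //; lra].
have supS : has_sup S.
  by split; [exists a|exists b => x [/andP[]]].
have ac : a <= sup S by apply: ub_le_sup => //; case: supS.
have cb : sup S <= b by apply: ge_sup; [exists a|move=> x [/andP[]]].
have [|d d0 H] := Ploc (sup S); first by rewrite ac cb.
have [x [/andP[ax xb] Pax] xd] := sup_adherent d0 supS.
have xc : x <= sup S.
  by apply: ub_le_sup; [case: supS|split; rewrite ?ax ?xb].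
have far y : sup S <= y -> y <= b -> y < sup S + d -> P a y.
  move=> cy yb yd; apply: (Ptrans a x y) => //; first by lra.
  exact: H.
have [bd|db] := ltP b (sup S + d); first exact: far.
have Py : P a (sup S + d / 2) by apply: far; lra.
have : sup S + d / 2 <= sup S.
  apply: ub_le_sup; first by case: supS.
  by split => //; apply/andP; split; lra.
lra.
Qed.

(** No mean value theorem holds for complex values, but the bound it would give
    follows from Cousin's lemma. The constant [C + 1] instead of [C] pays for the
    error term of the first-order expansion. *)
Lemma lipschitz_of_deriv (R : realType) (f df : R -> R[i]) (a b C : R) :
  a <= b -> (forall t, a <= t <= b -> has_deriv f t (df t)) ->
  (forall t, a <= t <= b -> cmod (df t) <= C) ->
  cmod (f b - f a) <= (C + 1) * (b - a).
Proof.
move=> ab fdf dfC.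
apply: (@cousin _ (fun x y => cmod (f y - f x) <= (C + 1) * (y - x))) => //.
  move=> x y z _ _ _ _ Pxy Pyz.
  have -> : f z - f x = (f z - f y) + (f y - f x) by ring.
  by rewrite (le_trans (cmodD _ _)) //; lra.
move=> t tab; have /has_derivP /(_ _ ltr01)[d d0 H] := fdf _ tab.
have {}H u : `|u - t| < d -> cmod (f u - f t) <= (C + 1) * `|u - t|.
  move=> /H; have -> : t + (u - t) = u by ring.
  rewrite mul1r => H1.
  have -> : f u - f t = f u - f t - (u - t)%:C * df t + (u - t)%:C * df t by ring.
  rewrite (le_trans (cmodD _ _)) // cmodM cmod_real.
  have : `|u - t| * cmod (df t) <= `|u - t| * C by rewrite ler_wpM2l ?dfC.
  lra.
exists d => // x y ax xt ty yb tx yt.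
have -> : f y - f x = (f y - f t) - (f x - f t) by ring.
rewrite (le_trans (cmodB _ _)) //.
have := H y; rewrite ger0_norm; last by lra.
have := H x; rewrite ler0_norm; last by lra.
move=> /(_ ltac:(lra)) h1 /(_ ltac:(lra)) h2.
lra.
Qed.

(** Cousin's lemma applied to the following trade-off: around a point either the
    slope is controlled, and the increment is paid for by [C * (b - a)], or the
    point has a neighbourhood inside [U], and the increment is stored in the list
    [l] of non-overlapping intervals inside [U]. *)
Lemma cover_increment (R : realType) (f : R -> R[i]) (U : set R) (a b C : R) :
  0 <= C -> a <= b ->
  (forall t, a <= t <= b -> exists2 delta : R, 0 < delta &
    (forall u, `|u - t| < delta -> U u) \/
    (forall u, `|u - t| < delta -> cmod (f u - f t) <= C * `|u - t|)) ->
  exists l : seq (R * R),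
   [/\ forall p, p \in l -> [/\ a <= p.1, p.1 <= p.2 & p.2 <= b],
       forall p, p \in l -> `]p.1, p.2[ `<=` U,
       pairwise (fun p q => p.2 <= q.1) l &
       cmod (f b - f a) <=
         C * (b - a) + \sum_(p <- l) cmod (f p.2 - f p.1)].
Proof.
move=> C0 ab H; apply: (@cousin _ (fun x y => exists l : seq (R * R),
   [/\ forall p, p \in l -> [/\ x <= p.1, p.1 <= p.2 & p.2 <= y],
       forall p, p \in l -> `]p.1, p.2[ `<=` U,
       pairwise (fun p q => p.2 <= q.1) l &
       cmod (f y - f x) <=
         C * (y - x) + \sum_(p <- l) cmod (f p.2 - f p.1)])) => //.
  move=> x y z _ xy yz _ [l [l1 l2 l3 l4]] [m [m1 m2 m3 m4]].
  exists (l ++ m); split.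
  - move=> p; rewrite mem_cat => /orP[/l1[]|/m1[]] h1 h2 h3; split => //; lra.
  - by move=> p; rewrite mem_cat => /orP[/l2|/m2].
  - rewrite pairwise_cat l3 m3 !andbT; apply/allrelP => p q /l1[_ _ h1] /m1[h2 _ _].
    by lra.
  - rewrite big_cat /=.
    have -> : f z - f x = (f z - f y) + (f y - f x) by ring.
    by rewrite (le_trans (cmodD _ _)) //; lra.
move=> t /H[d d0 []] {}H; exists d => // x y ax xt ty yb tx yt.
  exists [:: (x, y)]; split => //.
  - by move=> p; rewrite inE => /eqP -> /=; split; lra.
  - move=> p; rewrite inE => /eqP -> /= u /=; rewrite in_itv /= => /andP[xu uy].
    by apply: H; rewrite ltr_norml; apply/andP; split; lra.
  - by rewrite big_seq1 /= lerDr mulr_ge0 // subr_ge0 (le_trans xt).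
exists [::]; split => //; rewrite big_nil addr0.
have -> : f y - f x = (f y - f t) - (f x - f t) by ring.
rewrite (le_trans (cmodB _ _)) //.
have := H y; rewrite ger0_norm; last by lra.
have := H x; rewrite ler0_norm; last by lra.
move=> /(_ ltac:(lra)) h1 /(_ ltac:(lra)) h2.
lra.
Qed.

Lemma pairwise_lt_itv_trivIset (R : realType) (l : seq (R * R)) :
  (forall p, p \in l -> p.1 <= p.2) -> pairwise (fun p q => p.2 <= q.1) l ->
  trivIset setT (fun i : 'I_(size l) =>
    `](tnth (in_tuple l) i).1, (tnth (in_tuple l) i).2[%classic : set R).
Proof.
move=> l12 /(pairwiseP (0, 0)) lP.
have main (i j : 'I_(size l)) (x : R) : (i < j)%N ->
    `](tnth (in_tuple l) i).1, (tnth (in_tuple l) i).2[%classic x ->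
    `](tnth (in_tuple l) j).1, (tnth (in_tuple l) j).2[%classic x -> False.
  move=> ij; rewrite !(tnth_nth (0, 0)) /= !in_itv /= => /andP[_ h1] /andP[h2 _].
  have h := lP i j (ltn_ord i) (ltn_ord j) ij; lra.
move=> i j _ _ [x [xi xj]].
by case: (ltngtP i j) => [/main/(_ xi xj)//|/main/(_ xj xi)//|/val_inj].
Qed.

Lemma sum_itv_le_measure (R : realType) (U : set R) (l : seq (R * R)) :
  measurable U -> (forall p, p \in l -> p.1 <= p.2) ->
  (forall p, p \in l -> `]p.1, p.2[ `<=` U) ->
  pairwise (fun p q => p.2 <= q.1) l ->
  ((\sum_(p <- l) (p.2 - p.1))%:E <= lebesgue_measure U)%E.
Proof.
move=> mU l12 lU lP.
have tI := pairwise_lt_itv_trivIset l12 lP.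
rewrite big_tnth -sumEFin.
set F := (fun i : 'I_(size l) =>
    `](tnth (in_tuple l) i).1, (tnth (in_tuple l) i).2[%classic : set R) in tI.
rewrite (eq_bigr (fun i => lebesgue_measure (F i))); last first.
  move=> i _; rewrite /F lebesgue_measure_itv /= lte_fin.
  case: ltP => // h; have := l12 _ (mem_tnth i (in_tuple l)).
  rewrite le_eqVlt ltNge h orbF => /eqP ->; by rewrite subrr.
rewrite -measure_bigsetU_ord //; last first.
  by move=> i; exact: measurable_itv.
apply: le_measure; rewrite ?inE //.
  by apply: bigsetU_measurable => i _; exact: measurable_itv.
apply: (big_ind (fun A => A `<=` U)) => //.
  by move=> A B AU BU x [/AU|/BU].
by move=> i _; apply: lU; exact: mem_tnth.
Qed.

Lemma ac_sub (R : realType) (D : set R) (f g : R -> R[i]) :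
  abs_continuous D f -> abs_continuous D g ->
  abs_continuous D (fun t => f t - g t).
Proof.
move=> Hf Hg eps eps0; have e2 : 0 < eps / 2 by rewrite divr_gt0.
have [d d0 {}Hf] := Hf _ e2; have [d' d'0 {}Hg] := Hg _ e2.
exists (Num.min d d'); first by rewrite lt_min d0.
move=> n a b abD abI; rewrite lt_min => /andP[h1 h2].
rewrite [eps]splitr rmorphD /=.
apply: le_lt_trans (ltrD (Hf _ _ _ abD abI h1) (Hg _ _ _ abD abI h2)).
rewrite -big_split /=; apply: ler_sum => i _.
have -> : f (b i) - g (b i) - (f (a i) - g (a i)) =
  (f (b i) - f (a i)) - (g (b i) - g (a i)) by ring.
exact: ler_normB.
Qed.

(** The fundamental theorem for absolutely continuous functions, in the weak form of
    a bound on increments. The exceptional null set is covered by an open set [U] of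
    small measure; the intervals of [cover_increment] inside [U] then have a small
    total length, so that absolute continuity makes their contribution negligible. *)
Lemma ac_increment (R : realType) (D : set R) (f : R -> R[i]) (a b C : R) :
  abs_continuous D f -> (forall t, a <= t <= b -> D t) -> 0 <= C -> a <= b ->
  {ae (@lebesgue_measure R), forall t : R, a <= t <= b ->
     exists l : R[i], has_deriv f t l /\ cmod l <= C} ->
  cmod (f b - f a) <= C * (b - a).
Proof.
move=> fac abD C0 ab [B [mB B0 fB]]; apply/ler_addgt0Pr => e e0.
(* [h] is the excess slope allowed outside [U] and the total increment allowed inside. *)
pose h := e / (b - a + 1); have h0 : 0 < h by rewrite divr_gt0 //; lra.
have hE : h * (b - a) + h = e by rewrite /h; field; lra.
have [delta delta0 fdelta] := fac _ h0.
have [|U [oU BU mUB]] := lebesgue_regularity_outer mB _ delta0.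
  by rewrite [X in (X < _)%E]B0 ltry.
have mU : measurable U by exact: measurable_realfun.open_measurable.
have Udelta : (lebesgue_measure U < delta%:E)%E.
  apply: le_lt_trans mUB.
  have /= := measureU2 (@lebesgue_measure R) mB (measurableD mU mB).
  by rewrite setDUK // [X in (X + _)%E]B0 add0e.
have [|t tab|l [l1 l2 l3 l4]] := @cover_increment _ f U a b (C + h) _ ab.
- by lra.
- have [Bt|nBt] := pselect (B t).
    have : nbhs t U by apply: open_nbhs_nbhs; split => //; exact: BU.
    move=> /nbhs_ballP[d /= d0 H]; exists d => //; left => u ud.
    by apply: H; rewrite /ball /= distrC.
  have [l [fl lC]] : exists l : R[i], has_deriv f t l /\ cmod l <= C.
    by apply: contrapT => H; apply/nBt/fB => /= /(_ tab).
  have /has_derivP/(_ _ h0)[d d0 H] := fl.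
  exists d => //; right => u /H; have -> : t + (u - t) = u by ring.
  move=> H1.
  have -> : f u - f t = f u - f t - (u - t)%:C * l + (u - t)%:C * l by ring.
  rewrite (le_trans (cmodD _ _)) // cmodM cmod_real.
  have : `|u - t| * cmod l <= `|u - t| * C by rewrite ler_wpM2l.
  lra.
have l12 p : p \in l -> p.1 <= p.2 by move=> /l1[].
have sl : \sum_(p <- l) (p.2 - p.1) < delta.
  by rewrite -lte_fin (le_lt_trans _ Udelta) // sum_itv_le_measure.
have := fdelta _ (fun i : 'I_(size l) => (tnth (in_tuple l) i).1)
  (fun i : 'I_(size l) => (tnth (in_tuple l) i).2) _
  (pairwise_lt_itv_trivIset l12 l3).
rewrite -(big_tnth _ _ l xpredT (fun p => p.2 - p.1)).
rewrite -(big_tnth _ _ l xpredT (fun p => `|f p.2 - f p.1|)).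
have -> : \sum_(p <- l) `|f p.2 - f p.1| =
    (\sum_(p <- l) cmod (f p.2 - f p.1))%:C.
  by rewrite rmorph_sum.
rewrite ltcR => /(_ _ sl) sl2.
suff : \sum_(p <- l) cmod (f p.2 - f p.1) < h by lra.
apply: sl2 => i; have [h1 h2 h3] := l1 _ (mem_tnth i (in_tuple l)).
by split => //; apply: abD; apply/andP; split; lra.
Qed.

(** * A backward Gronwall lemma *)

Lemma ac_uniform (R : realType) (D : set R) (f : R -> R[i]) (eps : R) :
  abs_continuous D f -> 0 < eps ->
  exists2 delta : R, 0 < delta &
    forall x y, D x -> D y -> x <= y -> y - x < delta -> cmod (f y - f x) < eps.
Proof.
move=> fac /fac[d d0 H]; exists d => // x y Dx Dy xy yxd.
have := H 1%N (fun=> x) (fun=> y); rewrite !big_ord1 normE ltcR; apply => //.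
by move=> i j _ _ _; rewrite !ord1.
Qed.

Lemma lebesgue_aeS (R : realType) (P Q : R -> Prop) :
  (forall t, P t -> Q t) ->
  {ae (@lebesgue_measure R), forall t, P t} ->
  {ae (@lebesgue_measure R), forall t, Q t}.
Proof.
move=> PQ; apply: filterS => //.
exact: (ae_filter_ringOfSetsType (@lebesgue_measure R)).
Qed.

Lemma lebesgue_aeI (R : realType) (P Q : R -> Prop) :
  {ae (@lebesgue_measure R), forall t, P t} ->
  {ae (@lebesgue_measure R), forall t, Q t} ->
  {ae (@lebesgue_measure R), forall t, P t /\ Q t}.
Proof.
move=> Pae Qae; apply: filterI Pae Qae.
exact: (ae_filter_ringOfSetsType (@lebesgue_measure R)).
Qed.

(** Let [h] be so short that [4 * K * h <= 1]. On an interval of length at most [h]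
    the increments of [f] and of [g] are at most a quarter of the supremum of [N],
    so that the value at the right end controls the whole interval up to a factor 2.
    Chaining [k] such intervals gives [N a <= 2 ^+ k * N b]; now [b] tends to [L]
    while [k] stays fixed, and the right-hand side tends to 0. *)
Lemma backward_gronwall (R : realType) (L K : R) (f g : R -> R[i]) :
  let N := fun t => cmod (f t) + cmod (g t) in
  0 <= K ->
  abs_continuous `[0, L[ f -> abs_continuous `[0, L[ g ->
  {ae (@lebesgue_measure R), forall t : R, 0 <= t < L ->
    (exists l : R[i], has_deriv f t l /\ cmod l <= K * N t) /\
    (exists l : R[i], has_deriv g t l /\ cmod l <= K * N t)} ->
  (forall eps : R, 0 < eps -> exists2 delta : R, 0 < delta &
    forall t, 0 <= t < L -> L - delta < t -> N t < eps) ->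
  forall t, 0 <= t < L -> f t = 0 /\ g t = 0.
Proof.
move=> N K0 fac gac fg' fgL.
have N0 t : 0 <= N t by rewrite addr_ge0 ?cmod_ge0.
have [d d0 fd] := ac_uniform fac ltr01.
have [d' d'0 gd] := ac_uniform gac ltr01.
have [h h0 [hd hd' hK]] : exists2 h : R, 0 < h & [/\ h < d, h < d' & 4 * K * h <= 1].
  pose m := Num.min (d / 2) (Num.min (d' / 2) (4 * (K + 1))^-1).
  have K1 : 0 < (4 * (K + 1))^-1 by rewrite invr_gt0; lra.
  have m1 : m <= d / 2 by rewrite ge_min lexx.
  have m2 : m <= d' / 2 by rewrite !ge_min lexx orbT.
  have m3 : m <= (4 * (K + 1))^-1 by rewrite !ge_min lexx !orbT.
  have m0 : 0 < m by rewrite !lt_min K1 !divr_gt0.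
  exists m => //; split; [lra|lra|].
  apply: (@le_trans _ _ (4 * (K + 1) * m)).
    by rewrite ler_wpM2r ?ltW //; lra.
  by rewrite mulrC -ler_pdivlMr ?div1r //; lra.
have short a b : 0 <= a -> a <= b -> b < L -> b - a <= h -> N a <= 2 * N b.
  move=> a0 ab bL bah.
  have Dx x : a <= x -> x <= b -> `[0, L[%classic x.
    by move=> ax xb; rewrite /= in_itv /=; apply/andP; split; lra.
  pose S := [set N x | x in [set x | a <= x <= b]].
  have Sub : has_ubound S.
    exists (N b + 2) => _ [x /andP[ax xb] <-]; rewrite /N.
    have := fd x b (Dx x ax xb) (Dx b ab (lexx b)) xb ltac:(lra).
    have := gd x b (Dx x ax xb) (Dx b ab (lexx b)) xb ltac:(lra).
    rewrite cmod_distC (cmod_distC (f b)).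
    have := cmodD (f x - f b) (f b); have := cmodD (g x - g b) (g b).
    by rewrite !subrK; lra.
  have Sa : S (N a) by exists a => //=; rewrite lexx ab.
  have NS x : a <= x <= b -> N x <= sup S.
    by move=> xab; apply: ub_le_sup => //; exists x.
  have S0 : 0 <= sup S by rewrite (le_trans (N0 a)) // NS // lexx ab.
  have KS0 : 0 <= K * sup S by rewrite mulr_ge0.
  have incr (u : R -> R[i]) x : abs_continuous `[0, L[ u -> a <= x -> x <= b ->
      {ae (@lebesgue_measure R), forall t : R, 0 <= t < L ->
      (exists l : R[i], has_deriv u t l /\ cmod l <= K * N t)} ->
      cmod (u b - u x) <= K * sup S * h.
    move=> uac ax xb u'.
    apply: (@le_trans _ _ (K * sup S * (b - x))); last by rewrite ler_wpM2l //; lra.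
    apply: (ac_increment uac) => //.
      by move=> t /andP[xt tb]; apply: Dx => //; lra.
    apply: lebesgue_aeS u' => t H /andP[xt tb].
    have [|l [ul lK]] := H; first by apply/andP; split; lra.
    exists l; split => //; apply: (le_trans lK); rewrite ler_wpM2l // NS //.
    by apply/andP; split; lra.
  have Nx x : a <= x <= b -> N x <= N b + sup S / 2.
    move=> /andP[ax xb].
    have := incr f x fac ax xb; have := incr g x gac ax xb.
    move=> /(_ ltac:(by apply: lebesgue_aeS fg' => t H /H[])) h1.
    move=> /(_ ltac:(by apply: lebesgue_aeS fg' => t H /H[])) h2.
    have := cmodB (f b) (f b - f x); have := cmodB (g b) (g b - g x).
    rewrite !subKr /N => h3 h4.
    have : 4 * K * h * sup S <= 1 * sup S by rewrite ler_wpM2r.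
    lra.
  have : sup S <= N b + sup S / 2.
    by apply: ge_sup; [exists (N a)|move=> _ [x xab <-]; exact: Nx].
  have := NS a; rewrite lexx ab => /(_ isT).
  lra.
have long k a b : 0 <= a -> a <= b -> b < L -> b - a <= k%:R * h ->
    N a <= 2 ^+ k * N b.
  elim: k a => [|k IH] a a0 ab bL.
    rewrite mul0r expr0 mul1r => ba.
    by have -> : a = b by lra.
  rewrite mulrSr mulrDl mul1r exprSr -mulrA => bah.
  have [bah'|bah'] := leP (b - a) h.
    apply: (le_trans (short a b a0 ab bL bah')).
    rewrite ler_peMl ?mulr_ge0 //.
    by rewrite exprn_ege1 // ler1n.
  apply: (@le_trans _ _ (2 * N (a + h))).
    by apply: short => //; lra.
  rewrite mulrCA ler_pM2l //.
  by apply: IH; lra.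
move=> t /andP[t0 tL].
have [k kL] : exists k : nat, L <= k%:R * h.
  exists (Num.truncn (L / h)).+1; rewrite -ler_pdivrMr //.
  by rewrite ltW // truncnS_gt.
have Nt : N t = 0.
  apply/eqP; rewrite eq_le N0 andbT; apply/ler_addgt0Pr => e e0; rewrite add0r.
  have k0 : (0 : R) < 2 ^+ k by rewrite exprn_gt0.
  have [|s s0 H] := fgL (e / 2 ^+ k); first by rewrite divr_gt0.
  pose b := Num.max t (L - s / 2).
  have tb : t <= b by rewrite le_max lexx.
  have sb : L - s / 2 <= b by rewrite le_max lexx orbT.
  have bL : b < L by rewrite gt_max tL /=; lra.
  apply: (le_trans (long k t b t0 tb bL _)); first by lra.
  rewrite mulrC -ler_pdivlMr // ltW // H //; last by lra.
  by apply/andP; split; lra.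
have := cmod_ge0 (f t); have := cmod_ge0 (g t); move: Nt; rewrite /N => h1 h2 h3.
by split; apply: cmod_eq0; lra.
Qed.

(** * The flow of a single step *)

Definition ccos {R : realType} (w : R[i]) : R[i] :=
  (2^-1)%:C * (cexp ('i%C * w) + cexp (- ('i%C * w))).

Definition csin {R : realType} (w : R[i]) : R[i] :=
  (2^-1)%:C * 'i%C * (cexp (- ('i%C * w)) - cexp ('i%C * w)).

(** With [J = [[0, -1], [1, 0]]], the vector [J *m h *m v], vectors being kept as
    pairs so that identities between components are left to [ring]. *)
Definition generator {R : realType} (h : 'M[R]_2) (v : R[i] * R[i]) : R[i] * R[i] :=
  (- ((h 1 0)%:C * v.1 + (h 1 1)%:C * v.2), (h 0 0)%:C * v.1 + (h 0 1)%:C * v.2).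

(** [exp (w * J h)], when [h] is symmetric of determinant 1 and [J h] squares to [-1]. *)
Definition flow {R : realType} (h : 'M[R]_2) (w : R[i]) (v : R[i] * R[i]) :=
  (ccos w * v.1 + csin w * (generator h v).1, ccos w * v.2 + csin w * (generator h v).2).

Definition conj_pair {R : realType} (v : R[i] * R[i]) : R[i] * R[i] :=
  (conjc v.1, conjc v.2).

Lemma mulii (R : realType) : 'i%C * 'i%C = -1 :> R[i].
Proof. by rewrite -expr2 sqr_i. Qed.

Lemma add_halves (R : realType) : (2^-1)%:C + (2^-1)%:C = 1 :> R[i].
Proof. by rewrite -rmorphD /= -[in RHS](rmorph1 (real_complex R)); congr (_%:C); field. Qed.

Lemma cos2sin2C (R : realType) (w : R[i]) : ccos w * ccos w + csin w * csin w = 1.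
Proof.
rewrite /ccos /csin.
have := cexpN ('i%C * w); set u := cexp _; set v := cexp _ => uv.
have -> : (2^-1)%:C * (u + v) * ((2^-1)%:C * (u + v)) +
  (2^-1)%:C * 'i%C * (v - u) * ((2^-1)%:C * 'i%C * (v - u)) =
  (2^-1)%:C * (2^-1)%:C * ((u + v) ^+ 2 + 'i%C * 'i%C * (v - u) ^+ 2) by ring.
rewrite mulii.
have -> : (2^-1)%:C * (2^-1)%:C * ((u + v) ^+ 2 + -1 * (v - u) ^+ 2) =
   ((2^-1)%:C + (2^-1)%:C) * ((2^-1)%:C + (2^-1)%:C) * (u * v) by ring.
by rewrite add_halves uv !mulr1.
Qed.

Lemma ccosN (R : realType) (w : R[i]) : ccos (- w) = ccos w.
Proof. by rewrite /ccos mulrN opprK addrC. Qed.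

Lemma csinN (R : realType) (w : R[i]) : csin (- w) = - csin w.
Proof. by rewrite /csin mulrN opprK; ring. Qed.

Lemma ccos0 (R : realType) : ccos (0 : R[i]) = 1.
Proof. by rewrite /ccos mulr0 oppr0 cexp0 mulrDr mulr1 add_halves. Qed.

Lemma csin0 (R : realType) : csin (0 : R[i]) = 0.
Proof. by rewrite /csin mulr0 oppr0 cexp0 subrr mulr0. Qed.

Lemma conj_i (R : realType) : conjc ('i%C : R[i]) = - 'i%C.
Proof. by rewrite /= -{1}oppr0. Qed.

Lemma conjcD (R : realType) (z w : R[i]) : conjc (z + w) = conjc z + conjc w.
Proof. exact: rmorphD. Qed.

Lemma conjcN (R : realType) (z : R[i]) : conjc (- z) = - conjc z.
Proof. exact: rmorphN. Qed.

Lemma conjcM (R : realType) (z w : R[i]) : conjc (z * w) = conjc z * conjc w.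
Proof. exact: rmorphM. Qed.

Lemma conj_ccos (R : realType) (w : R[i]) : conjc (ccos w) = ccos (conjc w).
Proof.
by rewrite /ccos conjcM conjcD conjc_real !cexp_conj conjcN conjcM conj_i
  mulNr opprK addrC.
Qed.

Lemma conj_csin (R : realType) (w : R[i]) : conjc (csin w) = csin (conjc w).
Proof.
rewrite /csin 2!conjcM conjcD conjcN conjc_real !cexp_conj conjcN conjcM conj_i.
by rewrite mulNr opprK; ring.
Qed.

Lemma flow0 (R : realType) (h : 'M[R]_2) v : flow h 0 v = v.
Proof. by case: v => a b; rewrite /flow ccos0 csin0 /= !mul1r !mul0r !addr0. Qed.

Lemma conj_generator (R : realType) (h : 'M[R]_2) v :
  conj_pair (generator h v) = generator h (conj_pair v).
Proof. by rewrite /conj_pair /generator /= conjcN !conjcD !conjcM !conjc_real. Qed.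

Lemma conj_flow (R : realType) (h : 'M[R]_2) w v :
  conj_pair (flow h w v) = flow h (conjc w) (conj_pair v).
Proof.
rewrite /flow -conj_generator; case: (generator h v) => a b; rewrite /conj_pair /=.
by rewrite !conjcD !(conjcM (ccos w)) !(conjcM (csin w)) conj_ccos conj_csin.
Qed.

Definition sym_sl2 {R : realType} (h : 'M[R]_2) : Prop :=
  h 0 1 = h 1 0 /\ h 0 0 * h 1 1 - h 0 1 * h 1 0 = 1.

(** [J h] has trace 0 because [h] is symmetric and determinant 1 because [J] and [h]
    have, so that Cayley-Hamilton gives [(J h)^2 = -1]. *)
Lemma generatorK (R : realType) (h : 'M[R]_2) v :
  sym_sl2 h ->
  generator h (generator h v) = (- v.1, - v.2).
Proof.
move=> [hs hd]; rewrite /generator /=; congr pair; rewrite -hs; last first.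
  rewrite -hs in hd; have /(congr1 (real_complex R)) := hd.
  rewrite rmorphB !rmorphM rmorph1 /= => {}hd.
  transitivity (- ((h 0 0)%:C * (h 1 1)%:C - (h 0 1)%:C * (h 0 1)%:C) * v.2).
    by ring.
  by rewrite hd mulN1r.
rewrite -hs in hd; have /(congr1 (real_complex R)) := hd.
rewrite rmorphB !rmorphM rmorph1 /= => {}hd.
transitivity (- ((h 0 0)%:C * (h 1 1)%:C - (h 0 1)%:C * (h 0 1)%:C) * v.1).
  by ring.
by rewrite hd mulN1r.
Qed.

Lemma generator_flow (R : realType) (h : 'M[R]_2) w v :
  generator h (flow h w v) =
  (ccos w * (generator h v).1 + csin w * (generator h (generator h v)).1,
   ccos w * (generator h v).2 + csin w * (generator h (generator h v)).2).
Proof. by rewrite /flow /generator /=; congr pair; ring. Qed.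

Lemma flowNK (R : realType) (h : 'M[R]_2) w v :
  sym_sl2 h ->
  flow h (- w) (flow h w v) = v.
Proof.
move=> hh; rewrite [LHS]/flow generator_flow generatorK // ccosN csinN.
case: v => a b; rewrite /flow /=.
set g1 := - _; set g2 := _ + _ * b.
congr pair.
  transitivity ((ccos w * ccos w + csin w * csin w) * a); first by ring.
  by rewrite cos2sin2C mul1r.
transitivity ((ccos w * ccos w + csin w * csin w) * b); first by ring.
by rewrite cos2sin2C mul1r.
Qed.

Lemma flow_v0 (R : realType) (h : 'M[R]_2) w : flow h w (0, 0) = (0, 0).
Proof. by rewrite /flow /generator /= !mulr0 addr0 oppr0 !mulr0 addr0. Qed.

Lemma flow_neq0 (R : realType) (h : 'M[R]_2) w v :
  sym_sl2 h ->
  v <> (0, 0) -> flow h w v <> (0, 0).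
Proof.
move=> hh v0 fv0; apply: v0; rewrite -(flowNK w v hh) fv0.
exact: flow_v0.
Qed.

(** * Growth of the Wronskian *)

(** Up to a constant factor, this is the Hermitian form of [J]: it vanishes on real
    vectors and measures the difference between [|A - i B|] and [|A + i B|], see
    [cmod_sqr_sub_i]. *)
Definition wronskian {R : realType} (v : R[i] * R[i]) : R := complex.Im (conjc v.1 * v.2).

Definition quad_form {R : realType} (h : 'M[R]_2) (x y : R) : R :=
  h 0 0 * (x * x) + (h 0 1 + h 1 0) * (x * y) + h 1 1 * (y * y).

(** For symmetric [h] of determinant 1 one has [(Jh)^T J (Jh) = J], and the cross
    terms of [(c + s Jh)^* J (c + s Jh)] add up to a multiple of [h]. Hence the form
    of [J] is transported to a combination of itself and of the form of [h]. The
    coefficient of the latter is [Im (conj c * s) = sinh (2 Im w) / 2]; the form of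
    [h] at a complex vector is the sum of its values at the real and imaginary parts. *)
Lemma wronskian_flow (R : realType) (h : 'M[R]_2) w v :
  sym_sl2 h ->
  wronskian (flow h w v) =
    (cmod (ccos w) ^+ 2 + cmod (csin w) ^+ 2) * wronskian v +
    (expR (complex.Im w) ^+ 2 - expR (- complex.Im w) ^+ 2) / 4 *
    (quad_form h (complex.Re v.1) (complex.Re v.2) +
     quad_form h (complex.Im v.1) (complex.Im v.2)).
Proof.
move=> [hs hd].
have imcs : complex.Im (conjc (ccos w) * csin w) =
  (expR (complex.Im w) ^+ 2 - expR (- complex.Im w) ^+ 2) / 4.
  have cu := cmod_cexp ('i%C * w); have cv := cmod_cexp (- ('i%C * w)).
  have ru : complex.Re ('i%C * w) = - complex.Im w.
    by case: w {cu cv} => x y /=; ring.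
  have rv : complex.Re (- ('i%C * w)) = complex.Im w.
    by case: w {cu cv ru} => x y /=; ring.
  rewrite -{1}rv -cv -ru -cu !cmod_sqr /ccos /csin.
  case: (cexp ('i%C * w)) => a b; case: (cexp (- _)) => e f /=; by field.
rewrite -imcs !cmod_sqr /flow {imcs}.
move: (ccos w) (csin w) v => [c1 c2] [s1 s2] [[a b] [e f]].
rewrite /wronskian /quad_form /generator -!hs /= in hd *.
(* The determinant is isolated: it is the factor of the form of [J] in [(Jh)^T J (Jh)]. *)
transitivity ((c1 ^+ 2 + c2 ^+ 2 +
  (h 0 0 * h 1 1 - h 0 1 * h 0 1) * (s1 ^+ 2 + s2 ^+ 2)) * (a * f + - b * e) +
(c1 * s2 + - c2 * s1) *
(h 0 0 * (a * a) + (h 0 1 + h 0 1) * (a * e) + h 1 1 * (e * e) +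
 (h 0 0 * (b * b) + (h 0 1 + h 0 1) * (b * f) + h 1 1 * (f * f)))).
  by ring.
by rewrite hd; ring.
Qed.

Lemma quad_form_gt0 (R : realType) (h : 'M[R]_2) (x y : R) :
  posdefmx h -> (x, y) <> (0, 0) -> 0 < quad_form h x y.
Proof.
move=> hp xy0; have := hp (col2 x y).
have -> : ((col2 x y)^T *m h *m col2 x y) 0 0 = quad_form h x y.
  rewrite !mxE !big_ord_recl big_ord0 !mxE !big_ord_recl !big_ord0 /= !mxE /=.
  have -> : lift ord0 ord0 = 1 :> 'I_2 by exact: val_inj.
  by rewrite /quad_form /=; ring.
apply; apply/eqP => /matrixP c0; apply: xy0.
by have := c0 0 0; have := c0 1 0; rewrite !mxE /= => -> ->.
Qed.

Lemma wronskian_flow_gt0 (R : realType) (h : 'M[R]_2) w v :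
  sym_sl2 h -> posdefmx h ->
  0 < complex.Im w -> v <> (0, 0) -> 0 <= wronskian v -> 0 < wronskian (flow h w v).
Proof.
move=> hh hp w0 v0 wv; rewrite wronskian_flow //; apply: ltr_wpDl.
  by rewrite mulr_ge0 // addr_ge0 // exprn_ge0 // cmod_ge0.
apply: mulr_gt0.
  rewrite divr_gt0 // subr_gt0 ltrXn2r // ?nnegrE ?expR_ge0 // ltr_expR; lra.
case: v v0 {wv} => -[a b] [e f] v0 /=.
have q0 x y : 0 <= quad_form h x y.
  have [[-> ->]|/quad_form_gt0/ltW//] := pselect ((x, y) = (0, 0)).
    by rewrite /quad_form !mulr0 !addr0.
  exact.
have [[ae0 ee0]|h1] := pselect ((a, e) = (0, 0)); last first.
  by rewrite ltr_pwDl // quad_form_gt0.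
rewrite ltr_pwDr // quad_form_gt0 // => -[b0 f0]; apply: v0.
by rewrite ae0 ee0 b0 f0.
Qed.

Lemma cmod_sqr_sub_i (R : realType) (v : R[i] * R[i]) :
  cmod (v.1 - 'i%C * v.2) ^+ 2 = cmod (v.1 + 'i%C * v.2) ^+ 2 + 4 * wronskian v.
Proof.
by case: v => -[a b] [e f]; rewrite !cmod_sqr /wronskian /=; ring.
Qed.

(** * Bounded Lipschitz functions *)

(** Both bounds are kept together because only then are products covered; this
    is the regularity that [solution] inherits from its factors. *)
Definition bounded_lip {R : realType} (f : R -> R[i]) := exists K : R,
  [/\ 0 <= K, forall t, cmod (f t) <= K &
      forall t u, cmod (f t - f u) <= K * `|t - u|].

Lemma bounded_lip_cst (R : realType) (c : R[i]) : bounded_lip (fun _ : R => c).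
Proof.
exists (cmod c); split => [|//|t u]; first exact: cmod_ge0.
by rewrite subrr cmod0 mulr_ge0 ?cmod_ge0.
Qed.

Lemma bounded_lipD (R : realType) (f g : R -> R[i]) :
  bounded_lip f -> bounded_lip g -> bounded_lip (fun t => f t + g t).
Proof.
move=> [K [K0 Kb Kl]] [M [M0 Mb Ml]]; exists (K + M); split.
- by rewrite addr_ge0.
- by move=> t; rewrite (le_trans (cmodD _ _)) // lerD.
- move=> t u; have -> : f t + g t - (f u + g u) = (f t - f u) + (g t - g u) by ring.
  by rewrite (le_trans (cmodD _ _)) // mulrDl lerD.
Qed.

Lemma bounded_lipM (R : realType) (f g : R -> R[i]) :
  bounded_lip f -> bounded_lip g -> bounded_lip (fun t => f t * g t).
Proof.
move=> [K [K0 Kb Kl]] [M [M0 Mb Ml]].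
have KM0 : 0 <= K * M by rewrite mulr_ge0.
exists (K * M + K * M); split.
- by rewrite addr_ge0.
- move=> t; rewrite cmodM (@le_trans _ _ (K * M)) ?lerDl //.
  by rewrite ler_pM ?cmod_ge0.
- move=> t u.
  have -> : f t * g t - f u * g u = (f t - f u) * g t + f u * (g t - g u) by ring.
  rewrite (le_trans (cmodD _ _)) // !cmodM mulrDl lerD //.
    by rewrite mulrAC ler_pM ?cmod_ge0.
  by rewrite -mulrA ler_pM ?cmod_ge0.
Qed.

Lemma bounded_lipN (R : realType) (f : R -> R[i]) : bounded_lip f -> bounded_lip (fun t => - f t).
Proof.
move=> [K [K0 Kb Kl]]; exists K; split => // [t|t u]; first by rewrite cmodN.
by rewrite -opprD cmodN.
Qed.

Lemma eq_bounded_lip (R : realType) (f g : R -> R[i]) : f =1 g -> bounded_lip f -> bounded_lip g.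
Proof. by move=> /funext ->. Qed.

Lemma bounded_lip_cexp (R : realType) (c : R[i]) (p : R -> R) (r : R) :
  0 <= r -> (forall t, 0 <= p t <= r) -> (forall t u, `|p t - p u| <= `|t - u|) ->
  bounded_lip (fun t => cexp (c * (p t)%:C)).
Proof.
move=> r0 pr plip; pose M := expR (cmod c * r).
have M0 : 0 < M := expR_gt0 _.
have c0 := cmod_ge0 c.
have bound x : 0 <= x <= r -> cmod (cexp (c * x%:C)) <= M.
  move=> /andP[x0 xr]; rewrite cmod_cexp ler_expR.
  apply: (le_trans (ler_norm _)).
  apply: (le_trans (proj1 (ReIm_le_cmod _))).
  by rewrite cmodM cmod_real ger0_norm // ler_wpM2l.
have lip x y : 0 <= x -> x <= y -> y <= r ->
    cmod (cexp (c * y%:C) - cexp (c * x%:C)) <= (cmod c * M + 1) * (y - x).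
  move=> x0 xy yr.
  have E u : cexp (c * u%:C) = cexp (- c * (0 - u)%:C).
    by congr cexp; rewrite sub0r rmorphN mulrNN.
  rewrite !E; apply: (@lipschitz_of_deriv _ (fun u => cexp (- c * (0 - u)%:C))
    (fun u => - - c * cexp (- c * (0 - u)%:C))) => // t tab; first exact: has_deriv_cexp.
  rewrite cmodM cmodN cmodN -E ler_wpM2l // bound //.
  by case/andP: tab => h1 h2; apply/andP; split; lra.
have cM0 : 0 <= cmod c * M by rewrite mulr_ge0 // ltW.
exists (cmod c * M + 1 + M); split.
- by rewrite !addr_ge0 // ltW.
- by move=> t; rewrite (le_trans (bound _ (pr t))) // lerDr; lra.
- move=> t u; apply: (@le_trans _ _ ((cmod c * M + 1) * `|p t - p u|)); last first.
    by apply: ler_pM => //; lra.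
  have /andP[t0 tr] := pr t; have /andP[u0 ur] := pr u.
  have [ut|/ltW tu] := leP (p u) (p t).
    by rewrite ger0_norm ?subr_ge0 // lip.
  by rewrite cmod_distC distrC ger0_norm ?subr_ge0 // lip.
Qed.

Lemma bounded_lip_ac (R : realType) (D : set R) (f : R -> R[i]) :
  bounded_lip f -> abs_continuous D f.
Proof.
move=> [K [K0 _ Kl]] eps eps0; have K1 : 0 < K + 1 by lra.
exists (eps / (K + 1)); first by rewrite divr_gt0.
move=> n a b abD _; rewrite ltr_pdivlMr // => H.
have -> : \sum_(i < n) `|f (b i) - f (a i)| =
  (\sum_(i < n) cmod (f (b i) - f (a i)))%:C by rewrite rmorph_sum.
rewrite ltcR; apply: le_lt_trans H.
rewrite mulr_suml; apply: ler_sum => i _; apply: (le_trans (Kl _ _)).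
have [_ _ ab] := abD i; rewrite ger0_norm ?subr_ge0 // mulrC ler_wpM2l ?subr_ge0 //.
by lra.
Qed.

Lemma bounded_lip_cvg_left (R : realType) (f : R -> R[i]) (L : R) :
  bounded_lip f -> (f t : R[i]^o) @[t --> L^'-] --> (f L : R[i]^o).
Proof.
move=> [K [K0 _ Kl]]; apply/(@cvgrPdist_lt (R[i]) (R[i]^o)) => -[e e'].
rewrite ltcE /= => /andP[/eqP -> e0] {e'}; rewrite -[_ +i* _]/e%:C.
have K1 : 0 < K + 1 by lra.
rewrite near_withinE; apply/nbhs_ballP; exists (e / (K + 1)).
  by rewrite /= divr_gt0.
move=> t; rewrite /ball /= ltr_pdivlMr // => h _.
rewrite normE ltcR; apply: (le_lt_trans (Kl _ _)); apply: le_lt_trans h.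
by rewrite mulrC ler_wpM2l //; lra.
Qed.

(** * The solution of the quasi-canonical system *)

Definition step_end {R : realType} (d n : nat) : R := (sysr d)%:R * n%:R / 2.

(** The length of the part of step [n] that lies to the right of [t]. It is 1-Lipschitz
    in [t] on the whole line, full to the left of the step and 0 to its right. *)
Definition time_left {R : realType} (d n : nat) (t : R) : R :=
  Num.min ((sysr d)%:R / 2) (Num.max 0 (step_end d n - t)).

(** The flows of the steps listed in [s], the last one acting first. *)
Definition flow_steps {R : realType} (H : nat -> 'M[R]_2) (w : nat -> R[i]) (s : seq nat)
    (v : R[i] * R[i]) : R[i] * R[i] :=
  foldr (fun n u => flow (H n) (w n) u) v s.

(** At time [t] each step acts for the time that it has left. This closed form needs
    no case distinction on [t]: it is Lipschitz in [t] and entire in [z] because its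
    factors are, and in any given step it reduces to the flow of that step. *)
Definition solution {R : realType} (d : nat) (H : nat -> 'M[R]_2) (v : R[i] * R[i])
    (t : R) (z : R[i]) : R[i] * R[i] :=
  flow_steps H (fun n => z * (time_left d n t)%:C) (iota 1 d) v.

Lemma sysr_gt0 (R : realType) d : 0 < (sysr d)%:R :> R.
Proof. by rewrite /sysr; case: ifP => _; rewrite ltr0n. Qed.

Lemma sysLE (R : realType) d : (sysL d)%:R = step_end d d :> R.
Proof.
rewrite /step_end /sysL /sysr; case: ifPn => [_|dev]; first by field.
rewrite mul1r -[in RHS](even_halfK dev) -muln2 natrM.
by field.
Qed.

Lemma time_left_itv (R : realType) d n (t : R) : 0 <= time_left d n t <= (sysr d)%:R / 2.
Proof.
rewrite /time_left le_min ge_min lexx /= le_max lexx /= !andbT.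
by rewrite divr_ge0.
Qed.

Lemma time_left_lip (R : realType) d n (t u : R) :
  `|time_left d n t - time_left d n u| <= `|t - u|.
Proof.
rewrite /time_left; set r := _ / 2; set s := step_end d n.
wlog : t u / u <= t => [H|ut].
  by have [/H//|/ltW/H] := leP u t; rewrite distrC (distrC u).
rewrite ler_norml [`|t - u|]ger0_norm ?subr_ge0 //.
have r0 : 0 <= r by rewrite divr_ge0.
rewrite /Num.min /Num.max.
by case: (ltP 0 (s - t)) => ?; case: (ltP 0 (s - u)) => ?;
  (case: ltP => ?; case: ltP => ?); apply/andP; split; lra.
Qed.

Lemma bounded_lip_solution (R : realType) d (H : nat -> 'M[R]_2) v z :
  bounded_lip (fun t => (solution d H v t z).1) /\
  bounded_lip (fun t => (solution d H v t z).2).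
Proof.
rewrite /solution; elim: (iota 1 d) => [|n s [IH1 IH2]].
  by split; exact: bounded_lip_cst.
have lip_exp (c : R[i]) : bounded_lip (fun t => cexp (c * (time_left d n t)%:C)).
  apply: (@bounded_lip_cexp _ _ _ ((sysr d)%:R / 2)).
  - by rewrite divr_ge0.
  - exact: time_left_itv.
  - exact: time_left_lip.
have lip_cos : bounded_lip (fun t => ccos (z * (time_left d n t)%:C)).
  apply: bounded_lipM; first exact: bounded_lip_cst.
  apply: bounded_lipD; [apply: eq_bounded_lip (lip_exp ('i%C * z))|
    apply: eq_bounded_lip (lip_exp (- ('i%C * z)))].
    by move=> t; rewrite /= mulrA.
  by move=> t; rewrite /= mulNr mulrA.
have lip_sin : bounded_lip (fun t => csin (z * (time_left d n t)%:C)).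
  apply: bounded_lipM; first exact: bounded_lip_cst.
  apply: bounded_lipD; [apply: eq_bounded_lip (lip_exp (- ('i%C * z)))|].
    by move=> t; rewrite /= mulNr mulrA.
  apply: bounded_lipN; apply: eq_bounded_lip (lip_exp ('i%C * z)).
  by move=> t; rewrite /= mulrA.
split; (apply: bounded_lipD; apply: bounded_lipM => //).
  by apply: bounded_lipN; apply: bounded_lipD; apply: bounded_lipM => //; exact: bounded_lip_cst.
by apply: bounded_lipD; apply: bounded_lipM => //; exact: bounded_lip_cst.
Qed.

Lemma step_end_le (R : realType) d m n :
  (m <= n)%N -> step_end d m <= step_end d n :> R.
Proof.
by move=> mn; rewrite /step_end ler_wpM2r ?invr_ge0 // ler_wpM2l ?ler_nat.
Qed.

Lemma step_endS (R : realType) d n :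
  step_end d n.+1 = step_end d n + (sysr d)%:R / 2 :> R.
Proof. by rewrite /step_end mulrSr; ring. Qed.

Lemma in_stepE (R : realType) d n (t : R) :
  in_step d n.+1 t = (step_end d n <= t < step_end d n.+1).
Proof. by rewrite /in_step /step_end mulrSr addrK. Qed.

Lemma time_left_past (R : realType) d m (t : R) : step_end d m <= t -> time_left d m t = 0.
Proof.
move=> mt; rewrite /time_left max_l ?subr_le0 // min_r // divr_ge0.
Qed.

Lemma time_left_current (R : realType) d n (t : R) :
  step_end d n <= t <= step_end d n.+1 -> time_left d n.+1 t = step_end d n.+1 - t.
Proof.
rewrite /time_left step_endS => /andP[nt tn]; rewrite max_r; last by lra.
by rewrite min_r //; lra.
Qed.

Lemma time_left_future (R : realType) d m (t : R) :
  t <= step_end d m -> time_left d m.+1 t = (sysr d)%:R / 2.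
Proof.
have r0 : 0 <= (sysr d)%:R / 2 :> R by rewrite divr_ge0.
rewrite /time_left step_endS => tm; rewrite max_r; last by lra.
by rewrite min_l //; lra.
Qed.

Lemma in_step_cover (R : realType) d (t : R) : 0 <= t < (sysL d)%:R ->
  exists2 n, (n < d)%N & in_step d n.+1 t.
Proof.
rewrite sysLE => /andP[t0 tL]; have r0 := sysr_gt0 R d.
have : 0 <= 2 * t / (sysr d)%:R by rewrite divr_ge0 ?mulr_ge0 // ltW.
move/truncn_itv; set n := Num.truncn _ => /andP[].
rewrite ler_pdivlMr // ltr_pdivrMr // => h1 h2.
have h3 : step_end d n <= t by rewrite /step_end; lra.
have h4 : t < step_end d n.+1 by rewrite /step_end; lra.
exists n; last by rewrite in_stepE h3 h4.
rewrite ltnNge; apply/negP => /(step_end_le R d); lra.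
Qed.

Lemma in_step_inj (R : realType) d m n (t : R) :
  in_step d m.+1 t -> in_step d n.+1 t -> m = n.
Proof.
have half i j : (i < j)%N -> in_step d i.+1 t -> in_step d j.+1 t -> False.
  move=> /(step_end_le R d); rewrite !in_stepE => h /andP[_ h1] /andP[h2 _]; lra.
by move=> hm hn; case: (ltngtP m n) => // /half; [move/(_ hm hn)|move/(_ hn hm)].
Qed.

Lemma hamiltonianE (R : realType) d (H : nat -> 'M[R]_2) n t :
  (n < d)%N -> in_step d n.+1 t -> hamiltonian d H t = H n.+1.
Proof.
move=> nd nt; rewrite /hamiltonian.
rewrite big_mkcond (bigD1_seq n.+1) ?iota_uniq ?mem_index_iota //= nt.
rewrite big_seq_cond big1 ?addr0 // => -[|m]; first by rewrite mem_index_iota.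
move=> /andP[_ mn]; case: ifP => // /in_step_inj/(_ nt) mE.
by rewrite mE eqxx in mn.
Qed.

(** The value of the solution at the right end of step [n], all later steps being
    complete. *)
Definition value_at_end {R : realType} (d : nat) (H : nat -> 'M[R]_2) (v : R[i] * R[i])
    (n : nat) (z : R[i]) : R[i] * R[i] :=
  flow_steps H (fun=> z * ((sysr d)%:R / 2)%:C) (iota n.+1 (d - n)) v.

Lemma eq_flow_steps (R : realType) (H : nat -> 'M[R]_2) w1 w2 s v :
  {in s, w1 =1 w2} -> flow_steps H w1 s v = flow_steps H w2 s v.
Proof.
elim: s => //= n s IH w12; rewrite IH ?w12 ?mem_head // => m ms.
by rewrite w12 // in_cons ms orbT.
Qed.

Lemma flow_steps_id (R : realType) (H : nat -> 'M[R]_2) w s v :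
  {in s, forall n, w n = 0} -> flow_steps H w s v = v.
Proof.
move=> w0; rewrite (@eq_flow_steps _ _ _ (fun=> 0)); last by move=> n /w0.
by elim: s {w0} => //= n s ->; rewrite flow0.
Qed.

Lemma solution_in_step (R : realType) d (H : nat -> 'M[R]_2) v n t z :
  (n < d)%N -> step_end d n <= t <= step_end d n.+1 ->
  solution d H v t z =
    flow (H n.+1) (z * (step_end d n.+1 - t)%:C) (value_at_end d H v n.+1 z).
Proof.
move=> nd /[dup] ntn /andP[nt tn]; rewrite /solution.
have -> : iota 1 d = iota 1 n ++ n.+1 :: iota n.+2 (d - n.+1).
  have {1}-> : d = (n + (d - n.+1).+1)%N by rewrite addnS -addSn subnKC.
  by rewrite iotaD add1n.
rewrite /flow_steps foldr_cat -/(flow_steps H _ _ _) flow_steps_id; last first.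
  move=> m; rewrite mem_iota => /andP[_ mn].
  by rewrite time_left_past ?mulr0 // (le_trans _ nt) // step_end_le.
rewrite /= time_left_current //; congr flow; apply: eq_flow_steps => -[|m]; rewrite mem_iota //.
by move=> /andP[nm _]; rewrite time_left_future // (le_trans tn) // step_end_le.
Qed.

Lemma solution_right_end (R : realType) d (H : nat -> 'M[R]_2) v z :
  solution d H v (sysL d)%:R z = v.
Proof.
rewrite /solution flow_steps_id // => n; rewrite mem_iota sysLE => /andP[_ nd].
by rewrite time_left_past ?mulr0 // step_end_le.
Qed.

Lemma has_deriv_ccos (R : realType) (z : R[i]) (s t : R) :
  has_deriv (fun u => ccos (z * (s - u)%:C)) t (z * csin (z * (s - t)%:C)).
Proof.
have h1 := @has_deriv_cexp _ ('i%C * z) s t.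
have h2 := @has_deriv_cexp _ (- ('i%C * z)) s t.
have := has_derivZ (k := (2^-1)%:C) (has_derivD h1 h2).
have -> : z * csin (z * (s - t)%:C) =
  (2^-1)%:C * (- ('i%C * z) * cexp ('i%C * z * (s - t)%:C) +
       - - ('i%C * z) * cexp (- ('i%C * z) * (s - t)%:C)).
  by rewrite /csin (mulrA 'i%C z) -[- ('i%C * z * _)]mulNr; ring.
apply: (has_deriv_ext ltr01) => u _.
by rewrite /ccos (mulrA 'i%C z) -[- ('i%C * z * _)]mulNr.
Qed.

Lemma has_deriv_csin (R : realType) (z : R[i]) (s t : R) :
  has_deriv (fun u => csin (z * (s - u)%:C)) t (- (z * ccos (z * (s - t)%:C))).
Proof.
have h1 := @has_deriv_cexp _ ('i%C * z) s t.
have h2 := @has_deriv_cexp _ (- ('i%C * z)) s t.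
have := has_derivZ (k := (2^-1)%:C * 'i%C) (has_derivB h2 h1).
have -> : - (z * ccos (z * (s - t)%:C)) =
  (2^-1)%:C * 'i%C * (- - ('i%C * z) * cexp (- ('i%C * z) * (s - t)%:C)
    - (- ('i%C * z) * cexp ('i%C * z * (s - t)%:C))).
  rewrite /ccos (mulrA 'i%C z) -[- ('i%C * z * _)]mulNr.
  set u := cexp ('i%C * z * _); set v := cexp _.
  transitivity ('i%C * 'i%C * (z * (2^-1)%:C * (u + v))); last by ring.
  by rewrite mulii; ring.
apply: (has_deriv_ext ltr01) => u _.
by rewrite /csin (mulrA 'i%C z) -[- ('i%C * z * _)]mulNr.
Qed.

Lemma has_deriv_flow (R : realType) (h : 'M[R]_2) (v : R[i] * R[i]) (z : R[i]) (s t : R) :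
  sym_sl2 h ->
  let y := fun u => flow h (z * (s - u)%:C) v in
  has_deriv (fun u => (y u).1) t (- (z * (generator h (y t)).1)) /\
  has_deriv (fun u => (y u).2) t (- (z * (generator h (y t)).2)).
Proof.
move=> hh y; rewrite /y generator_flow generatorK //=.
split.
  have := has_derivD (has_derivZ (k := v.1) (@has_deriv_ccos _ z s t))
    (has_derivZ (k := (generator h v).1) (@has_deriv_csin _ z s t)).
  set l := _ + _ => H.
  have -> : - (z * (ccos (z * (s - t)%:C) * (generator h v).1 + csin (z * (s - t)%:C) * - v.1))
     = l by rewrite /l; ring.
  by apply: (has_deriv_ext ltr01) H => u _; rewrite /flow /=; ring.
have := has_derivD (has_derivZ (k := v.2) (@has_deriv_ccos _ z s t))
  (has_derivZ (k := (generator h v).2) (@has_deriv_csin _ z s t)).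
set l := _ + _ => H.
have -> : - (z * (ccos (z * (s - t)%:C) * (generator h v).2 + csin (z * (s - t)%:C) * - v.2))
   = l by rewrite /l; ring.
by apply: (has_deriv_ext ltr01) H => u _; rewrite /flow /=; ring.
Qed.

Lemma sym_sl2_entries (R : realType) (h : 'M[R]_2) :
  h \is symmetricmx -> \det h = 1 ->
  sym_sl2 h.
Proof.
move=> /is_hermitianmxP/matrixP hs hd; split.
  by rewrite (hs 0 1) !mxE /= mul1r.
rewrite -hd (expand_det_row _ ord0) !big_ord_recl big_ord0 addr0 /cofactor.
rewrite !det_mx11 !mxE /= expr0 mul1r expr1 mulN1r mulrN.
have -> : lift ord0 ord0 = 1 :> 'I_2 by exact: val_inj.
by have -> : lift (1 : 'I_2) (0 : 'I_1) = 0 by exact: val_inj.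
Qed.

(** * Existence and uniqueness of the solution *)

Lemma system_vec (R : realType) (h : 'M[R]_2) (a b : R[i]) :
  sympl *m map_mx (real_complex R) h *m col2 a b =
  col2 (generator h (a, b)).1 (generator h (a, b)).2.
Proof.
rewrite -mulmxA; apply/matrixP => i j; rewrite !mxE !big_ord_recl !big_ord0 /=.
rewrite !mxE !big_ord_recl !big_ord0 /= !mxE /=.
have -> : lift ord0 ord0 = 1 :> 'I_2 by exact: val_inj.
rewrite /generator /=; case: i => -[|[|//]] ilt /=.
  by rewrite subrr mul0r add0r sub0r mulN1r !addr0.
by rewrite subr0 subrr mul1r mul0r !addr0.
Qed.

Lemma ae_off_countable (R : realType) (S : set R) (P : R -> Prop) :
  countable S -> (forall t, ~ S t -> P t) ->
  {ae (@lebesgue_measure R), forall t, P t}.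
Proof.
move=> cS SP; exists S; split.
- by apply: countable_measurable => // t; exact: measurable_set1.
- exact: countable_lebesgue_measure0.
- by move=> t /= nP; apply: contrapT => /SP.
Qed.

Lemma solution_solves (R : realType) d (H : nat -> 'M[R]_2) (A0 B0 : R) :
  (forall n, (1 <= n <= d)%N -> H n \is symmetricmx) ->
  (forall n, (1 <= n <= d)%N -> \det (H n) = 1) ->
  let Y := solution d H (A0%:C, B0%:C) in
  quasi_canonical_solution (sysL d)%:R (hamiltonian d H) A0 B0
    (fun t z => (Y t z).1) (fun t z => (Y t z).2).
Proof.
move=> Hs Hd Y z; have [b1 b2] := bounded_lip_solution d H (A0%:C, B0%:C) z.
split; first by split; exact: bounded_lip_ac.
- apply: (@ae_off_countable _ (range (step_end d))); first exact: card_image_le.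
  move=> t tS tL; have [n nd nt] := in_step_cover tL.
  have /andP[n1 n2] := nt; rewrite in_stepE in nt.
  have {nt} /andP[t1 t2] : step_end d n < t < step_end d n.+1.
    case/andP: nt => + ->; rewrite andbT le_eqVlt => /orP[/eqP E|//].
    by case: tS; exists n.
  have hh := sym_sl2_entries (Hs n.+1 nd) (Hd n.+1 nd).
  pose y u := flow (H n.+1) (z * (step_end d n.+1 - u)%:C)
     (value_at_end d H (A0%:C, B0%:C) n.+1 z).
  pose delta := Num.min (t - step_end d n) (step_end d n.+1 - t).
  have delta0 : 0 < delta by rewrite lt_min !subr_gt0 t1.
  have Yy u : `|u - t| < delta -> Y u z = y u.
    rewrite lt_min => /andP[]; rewrite !ltr_norml => /andP[u1 _] /andP[_ u2].
    by apply: solution_in_step => //; apply/andP; split; lra.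
  have [y1 y2] := @has_deriv_flow _ _ (value_at_end d H (A0%:C, B0%:C) n.+1 z) z
    (step_end d n.+1) t hh.
  have yt : y t = Y t z by rewrite Yy // subrr normr0.
  rewrite -/(y t) yt in y1 y2.
  exists (col2 (- (z * (generator (H n.+1) (Y t z)).1)) (- (z * (generator (H n.+1) (Y t z)).2))).
  split.
  + by rewrite mxE /=; apply: has_deriv_ext delta0 _ y1 => u /Yy ->.
  + by rewrite mxE /=; apply: has_deriv_ext delta0 _ y2 => u /Yy ->.
  + rewrite (@hamiltonianE _ _ _ n) //; last by rewrite /in_step n1 n2.
    rewrite system_vec -surjective_pairing; apply/matrixP => i j; rewrite !mxE /=.
    by case: ifP => _; rewrite opprK.
- have YL : Y (sysL d)%:R z = (A0%:C, B0%:C) := solution_right_end _ _ _ _.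
  have YL1 : (Y (sysL d)%:R z).1 = A0%:C by rewrite YL.
  have YL2 : (Y (sysL d)%:R z).2 = B0%:C by rewrite YL.
  split; first by rewrite -YL1; exact: bounded_lip_cvg_left b1.
  by rewrite -YL2; exact: bounded_lip_cvg_left b2.
Qed.

Lemma hamiltonian_bound (R : realType) d (H : nat -> 'M[R]_2) :
  exists2 K : R, 0 <= K & forall t i j, `|hamiltonian d H t i j| <= K.
Proof.
exists (\sum_(1 <= n < d.+1) \sum_(i < 2) \sum_(j < 2) `|H n i j|).
  by rewrite sumr_ge0 // => n _; rewrite sumr_ge0 // => i _; rewrite sumr_ge0.
move=> t i j; rewrite /hamiltonian summxE (le_trans (ler_norm_sum _ _ _)) //.
rewrite big_mkcond /=; apply: ler_sum => n _.
have H0 : `|H n i j| <= \sum_(i < 2) \sum_(j < 2) `|H n i j|.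
  rewrite (bigD1 i) //= (bigD1 j) //= -addrA lerDl.
  by rewrite addr_ge0 // sumr_ge0 // => k _; rewrite sumr_ge0.
by case: ifP => // _; exact: le_trans H0.
Qed.

Lemma generator_bound (R : realType) (h : 'M[R]_2) (K : R) (z : R[i]) v :
  (forall i j, `|h i j| <= K) ->
  cmod (z * (generator h v).1) <= cmod z * K * (cmod v.1 + cmod v.2) /\
  cmod (z * (generator h v).2) <= cmod z * K * (cmod v.1 + cmod v.2).
Proof.
have v1 := cmod_ge0 v.1; have v2 := cmod_ge0 v.2.
move=> hK; have two (a b : R) : `|a| <= K -> `|b| <= K ->
    cmod (a%:C * v.1 + b%:C * v.2) <= K * (cmod v.1 + cmod v.2).
  move=> aK bK; rewrite (le_trans (cmodD _ _)) // !cmodM !cmod_real mulrDr.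
  by rewrite lerD // ler_wpM2r.
by rewrite /generator /= !cmodM cmodN -!mulrA; split; rewrite ler_wpM2l ?cmod_ge0 ?two.
Qed.

Lemma system_entries (R : realType) (h : 'M[R]_2) (y : 'cV[R[i]]_2) (z a b : R[i]) :
  - y = z *: (sympl *m map_mx (real_complex R) h *m col2 a b) ->
  y 0 0 = - (z * (generator h (a, b)).1) /\ y 1 0 = - (z * (generator h (a, b)).2).
Proof.
rewrite system_vec => /matrixP yE; have := yE 0 0; have := yE 1 0.
by rewrite !mxE /= => <- <-; rewrite !opprK.
Qed.

Lemma generatorB (R : realType) (h : 'M[R]_2) (u v : R[i] * R[i]) :
  generator h (u.1 - v.1, u.2 - v.2) =
  ((generator h u).1 - (generator h v).1, (generator h u).2 - (generator h v).2).
Proof. by rewrite /generator /=; congr pair; ring. Qed.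

(** The difference of two solutions satisfies the homogeneous system with limit 0 at
    [L], which falls under [backward_gronwall] because the Hamiltonian takes finitely
    many values. *)
Lemma solution_unique (R : realType) d (H : nat -> 'M[R]_2) (A0 B0 L : R)
    (A B A' B' : R -> R[i] -> R[i]) :
  quasi_canonical_solution L (hamiltonian d H) A0 B0 A B ->
  quasi_canonical_solution L (hamiltonian d H) A0 B0 A' B' ->
  forall t z, 0 <= t < L -> A' t z = A t z /\ B' t z = B t z.
Proof.
move=> sol sol' t z tL.
have [[Aac Bac] AB [Alim Blim]] := sol z.
have [[Aac' Bac'] AB' [Alim' Blim']] := sol' z.
have [K K0 HK] := hamiltonian_bound d H.
suff [f0 g0] : A' t z - A t z = 0 /\ B' t z - B t z = 0.
  by split; apply/eqP; rewrite -subr_eq0; apply/eqP.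
apply: (@backward_gronwall R L (cmod z * K)
  (fun t => A' t z - A t z) (fun t => B' t z - B t z)
  (mulr_ge0 (cmod_ge0 _) K0) (ac_sub Aac' Aac) (ac_sub Bac' Bac) _ _ t tL).
- apply: lebesgue_aeS (lebesgue_aeI AB AB') => s [+ +] sL.
  move=> /(_ sL)[y [yA yB yE]] /(_ sL)[y' [yA' yB' yE']].
  have [y0 y1] := system_entries yE; have [y0' y1'] := system_entries yE'.
  have [g1 g2] := generator_bound z (A' s z - A s z, B' s z - B s z) (HK s).
  rewrite (generatorB _ (A' s z, B' s z) (A s z, B s z)) /= in g1 g2.
  split.
    exists (y' 0 0 - y 0 0); split; first exact: has_derivB.
    by rewrite y0 y0' -cmodN opprB opprK addrC -mulrBr.
  exists (y' 1 0 - y 1 0); split; first exact: has_derivB.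
  by rewrite y1 y1' -cmodN opprB opprK addrC -mulrBr.
- move=> eps eps0.
  have e4 : 0 < (eps / 4)%:C by rewrite ltcR divr_gt0.
  move/(@cvgrPdist_lt (R[i]) (R[i]^o))/(_ _ e4): Alim.
  move/(@cvgrPdist_lt (R[i]) (R[i]^o))/(_ _ e4): Blim.
  move/(@cvgrPdist_lt (R[i]) (R[i]^o))/(_ _ e4): Alim'.
  move/(@cvgrPdist_lt (R[i]) (R[i]^o))/(_ _ e4): Blim'.
  rewrite !near_withinE => /nbhs_ballP[d1 /= d10 H1] /nbhs_ballP[d2 /= d20 H2]
   /nbhs_ballP[d3 /= d30 H3] /nbhs_ballP[d4 /= d40 H4].
  exists (Num.min d1 (Num.min d2 (Num.min d3 d4))).
    by rewrite !lt_min d10 d20 d30.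
  move=> s /andP[s0 sL]; rewrite ltrBlDl -ltrBlDr => Ls.
  have Lsn : `|L - s| = L - s by rewrite ger0_norm ?subr_ge0 // ltW.
  move: Ls; rewrite -Lsn !lt_min => /and4P[l1 l2 l3 l4].
  have := H1 s l1 sL; have := H2 s l2 sL; have := H3 s l3 sL; have := H4 s l4 sL.
  rewrite !normE !ltcR => h1 h2 h3 h4.
  have -> : A' s z - A s z = (A0%:C - A s z) - (A0%:C - A' s z) by ring.
  have -> : B' s z - B s z = (B0%:C - B s z) - (B0%:C - B' s z) by ring.
  have := cmodB (A0%:C - A s z) (A0%:C - A' s z).
  have := cmodB (B0%:C - B s z) (B0%:C - B' s z).
  lra.
Qed.

(** * Exponential sums *)

(** The integers where [exp_sum] evaluates its coefficient functions; the frequencies at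
    time [t] are their differences with [t]. *)
Definition freq (d j : nat) : int := (sysL d)%:Z - (sysr d * j)%:Z.

Definition exp_pair {R : realType} (p q : int -> R[i]) (t : R) (z : R[i]) (k : int) : R[i] :=
  p k * cexp ('i%C * (k%:~R - t)%:C * z) + q k * cexp (- ('i%C * (k%:~R - t)%:C * z)).

Lemma half_real (R : realType) : 2^-1 = (2^-1)%:C :> R[i].
Proof. by rewrite fmorphV rmorph_nat. Qed.

Lemma exp_sumE (R : realType) d n (p q : int -> R[i]) t z :
  exp_sum d n p q t z =
  (2^-1)%:C * \sum_(0 <= j < (d - n).+1) exp_pair p q t z (freq d j).
Proof. by rewrite /exp_sum half_real. Qed.

Lemma sysL2 d : (sysL d).*2 = (sysr d * d)%N.
Proof.
rewrite /sysL /sysr; case: ifPn => [_|/even_halfK ->]; last by rewrite mul1n.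
by rewrite mul2n.
Qed.

(** Reflection at the right end of step [n] reverses the list of frequencies, because
    [2 * L = r * d]. *)
Lemma freq_rev d n j : (n < d)%N -> (j <= d - n)%N ->
  (sysr d * n)%:Z - freq d j = freq d (d - n - j).
Proof.
move=> nd jd; rewrite /freq; have := sysL2 d.
move: (sysL d) (sysr d) => L r; rewrite !mulnBr -addnn; move/(congr1 Posz).
have h1 : (r * n <= r * d)%N by rewrite leq_mul2l ltnW ?orbT.
have h2 : (r * j <= r * d - r * n)%N by rewrite -mulnBr leq_mul2l jd orbT.
by rewrite PoszD -!subzn // => E; lia.
Qed.

Lemma exp_sum_lin (R : realType) d n (c1 c2 : R[i]) (p q p' q' : int -> R[i]) t z :
  c1 * exp_sum d n p q t z + c2 * exp_sum d n p' q' t z =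
  exp_sum d n (fun k => c1 * p k + c2 * p' k) (fun k => c1 * q k + c2 * q' k) t z.
Proof.
rewrite !exp_sumE !(mulrCA _ (2^-1)%:C) -mulrDr; congr (_ * _).
rewrite !mulr_sumr -big_split /=; apply: eq_bigr => j _.
by rewrite /exp_pair; ring.
Qed.

Lemma eq_exp_sum (R : realType) d n (p q p' q' : int -> R[i]) t z :
  p =1 p' -> q =1 q' -> exp_sum d n p q t z = exp_sum d n p' q' t z.
Proof. by move=> /funext -> /funext ->. Qed.

Definition conj_exp_sum {R : realType} d n (p : int -> R[i]) (t : R) z :=
  exp_sum d n p (fun k => conjc (p k)) t z.

Lemma generator_conj_exp_sum (R : realType) (h : 'M[R]_2) d n (a b : int -> R[i]) (t : R) z :
  generator h (conj_exp_sum d n a t z, conj_exp_sum d n b t z) =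
  (conj_exp_sum d n (fun k => (generator h (a k, b k)).1) t z,
   conj_exp_sum d n (fun k => (generator h (a k, b k)).2) t z).
Proof.
rewrite {1}/generator /=; congr pair; last first.
  by rewrite exp_sum_lin; apply: eq_exp_sum => k //=; rewrite conjcD !conjcM !conjc_real.
rewrite opprD -!mulNr exp_sum_lin; apply: eq_exp_sum => k /=.
  by rewrite !mulNr opprD.
by rewrite conjcN conjcD !conjcM !conjc_real !mulNr opprD.
Qed.

(** Going back across one step sends the pair of coefficients at the frequency [k] to
    the frequency [k] and, conjugated, to the reflected frequency [kappa - k]; here
    [kappa] is twice the time of the crossing, and [p'] holds the coefficients of the
    image under the generator. *)
Definition prev_coef {R : realType} (p p' : int -> R[i]) (kappa k : int) : R[i] :=
  (2^-1)%:C * (p k - 'i%C * p' k) +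
  (2^-1)%:C * (conjc (p (kappa - k)) - 'i%C * conjc (p' (kappa - k))).

(** The flow multiplies by [e^(i (s - t) z)] and its inverse. One of the two products
    only replaces [s] by [t] in the exponential of frequency [k]; the other one yields
    frequency [kappa - k], since [(s - t) - (k - s) = (kappa - k) - t]. *)
Lemma flow_exp_pair (R : realType) (p p' : int -> R[i]) (kappa k : int) (s t : R) z :
  kappa%:~R = 2 * s ->
  let u k := (2^-1)%:C * (p k - 'i%C * p' k) in
  let u' k := (2^-1)%:C * (conjc (p (kappa - k)) - 'i%C * conjc (p' (kappa - k))) in
  ccos (z * (s - t)%:C) * exp_pair p (fun k => conjc (p k)) s z k +
  csin (z * (s - t)%:C) * exp_pair p' (fun k => conjc (p' k)) s z k =
  exp_pair u (fun k => conjc (u k)) t z k +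
  exp_pair u' (fun k => conjc (u' k)) t z (kappa - k).
Proof.
move=> ks u u'; rewrite /ccos /csin /exp_pair.
set e := cexp ('i%C * (z * _)); set e' := cexp (- ('i%C * (z * _))).
set f := cexp ('i%C * _ * z); set f' := cexp (- ('i%C * _ * z)).
have -> : cexp ('i%C * (k%:~R - t)%:C * z) = e * f.
  by rewrite -cexpD; congr cexp; rewrite !rmorphB /=; ring.
have -> : cexp (- ('i%C * (k%:~R - t)%:C * z)) = e' * f'.
  by rewrite -cexpD; congr cexp; rewrite !rmorphB /=; ring.
have kE : (kappa - k)%:~R - t = (s - t) - (k%:~R - s) :> R.
  by rewrite rmorphB /= ks; ring.
have -> : cexp ('i%C * ((kappa - k)%:~R - t)%:C * z) = e * f'.
  by rewrite kE -cexpD; congr cexp; rewrite !rmorphB /=; ring.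
have -> : cexp (- ('i%C * ((kappa - k)%:~R - t)%:C * z)) = e' * f.
  by rewrite kE -cexpD; congr cexp; rewrite !rmorphB /=; ring.
have conj_u (x y : R[i]) : conjc ((2^-1)%:C * (x - 'i%C * y)) =
    (2^-1)%:C * (conjc x + 'i%C * conjc y).
  by rewrite conjcM conjc_real conjcD conjcN conjcM conj_i mulNr opprK.
rewrite /u /u' !conj_u !conjcK subKr.
by ring.
Qed.

(** The step adds one frequency. The sum of the terms of frequency [k] is extended at
    its end, and the sum of the reflected terms at its beginning, by a zero term: this
    is what the vanishing of [p] and [p'] at the new frequency is for. *)
Lemma flow_conj_exp_sum (R : realType) d n (p p' : int -> R[i]) (t : R) z :
  (n.+1 < d)%N -> p (freq d (d - n.+1)) = 0 -> p' (freq d (d - n.+1)) = 0 ->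
  let s := step_end d n.+1 in
  ccos (z * (s - t)%:C) * conj_exp_sum d n.+2 p s z +
  csin (z * (s - t)%:C) * conj_exp_sum d n.+2 p' s z =
  conj_exp_sum d n.+1 (prev_coef p p' (sysr d * n.+1)%:Z) t z.
Proof.
move=> nd p0 p'0 s; set kappa := Posz _.
have ks : kappa%:~R = 2 * s.
  by rewrite /kappa /s /step_end -pmulrn natrM; field.
rewrite /conj_exp_sum !exp_sumE !(mulrCA _ (2^-1)%:C) -mulrDr; congr (_ * _).
rewrite !mulr_sumr -big_split /= subnSK //.
rewrite (eq_bigr _ (fun j _ => flow_exp_pair p p' (freq d j) t z ks)) big_split /=.
set u := fun k => (2^-1)%:C * (p k - 'i%C * p' k).
set u' := fun k => (2^-1)%:C * (conjc (p (kappa - k)) - 'i%C * conjc (p' (kappa - k))).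
have -> : \sum_(0 <= j < d - n.+1) exp_pair u (fun k => conjc (u k)) t z (freq d j) =
    \sum_(0 <= j < (d - n.+1).+1) exp_pair u (fun k => conjc (u k)) t z (freq d j).
  rewrite big_nat_recr //= /exp_pair /u p0 p'0.
  by rewrite mulr0 subrr mulr0 conjc0 !mul0r !addr0.
have -> : \sum_(0 <= j < d - n.+1)
      exp_pair u' (fun k => conjc (u' k)) t z (kappa - freq d j) =
    \sum_(0 <= j < (d - n.+1).+1) exp_pair u' (fun k => conjc (u' k)) t z (freq d j).
  rewrite [RHS]big_nat_rev /= add0n big_nat_recr //= !subSS subnn.
  rewrite [X in _ + X](_ : _ = 0) ?addr0; last first.
    have E : kappa - freq d 0 = freq d (d - n.+1) by rewrite freq_rev ?subn0 // ltnW.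
    rewrite /exp_pair /u' E p0 p'0 conjc0.
    by rewrite mulr0 subrr mulr0 conjc0 !mul0r !addr0.
  apply: eq_big_nat => j /andP[_ jd].
  by rewrite subSS freq_rev // ltnW.
rewrite -big_split /=; apply: eq_bigr => j _.
by rewrite /exp_pair /prev_coef -/(u _) -/(u' _) !conjcD; ring.
Qed.

(** Downward induction on the step. That the coefficients vanish away from the
    frequencies of their step is carried along for [flow_conj_exp_sum], which needs it
    at one more frequency. *)
Lemma step_coefficients (R : realType) d (H : nat -> 'M[R]_2) (A0 B0 : R) n :
  (n < d)%N -> exists a b : int -> R[i],
  (forall k, (forall j, (j <= d - n.+1)%N -> k <> freq d j) -> a k = 0 /\ b k = 0) /\
  forall t z, flow (H n.+1) (z * (step_end d n.+1 - t)%:C)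
     (value_at_end d H (A0%:C, B0%:C) n.+1 z) =
   (conj_exp_sum d n.+1 a t z, conj_exp_sum d n.+1 b t z).
Proof.
move=> nd; move mE : (d - n.+1)%N => m.
elim: m n nd mE => [|m IH] n nd mE.
  have dE : d = n.+1 by apply/eqP; rewrite eqn_leq nd andbT -subn_eq0 mE.
  pose g := generator (H n.+1) (A0%:C, B0%:C).
  pose single (x y : R[i]) k : R[i] := if k == freq d 0 then x - 'i%C * y else 0.
  exists (single A0%:C g.1), (single B0%:C g.2); split.
    by move=> k /(_ 0 (leqnn _)) /eqP kn; rewrite /single (negPf kn).
  move=> t z; rewrite /value_at_end mE /flow -[flow_steps _ _ _ _]/(A0%:C, B0%:C) -/g.
  have key (x : R) (y : R[i]) : conjc y = y ->
    ccos (z * (step_end d n.+1 - t)%:C) * x%:C +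
    csin (z * (step_end d n.+1 - t)%:C) * y = conj_exp_sum d n.+1 (single x%:C y) t z.
    move=> yr; rewrite /conj_exp_sum exp_sumE mE big_nat1 /exp_pair /single eqxx.
    rewrite conjcD conjc_real conjcN conjcM conj_i yr mulNr opprK.
    have -> : (freq d 0)%:~R = step_end d n.+1 :> R.
      by rewrite -dE /freq muln0 subr0 -sysLE -pmulrn.
    rewrite /ccos /csin -(mulrA 'i%C (_%:C) z) (mulrC (_%:C) z).
    set e := cexp _; set e' := cexp _.
    transitivity ((2^-1)%:C * ((x%:C - 'i%C * y) * e + (x%:C + 'i%C * y) * e')).
      by ring.
    by [].
  have [g1 g2] : conjc g.1 = g.1 /\ conjc g.2 = g.2.
    have E : conj_pair (A0%:C, B0%:C) = (A0%:C, B0%:C) by rewrite /conj_pair !conjc_real.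
    have := conj_generator (H n.+1) (A0%:C, B0%:C).
    rewrite E /g; case: (generator _ _) => x y eq_xy; split.
      exact: (congr1 fst eq_xy).
    exact: (congr1 snd eq_xy).
  by rewrite -!key.
have nd1 : (n.+1 < d)%N by rewrite -subn_gt0 mE.
have [|a [b [ab0 abE]]] := IH n.+1 nd1; first by rewrite subnS mE.
pose a' k := (generator (H n.+1) (a k, b k)).1.
pose b' k := (generator (H n.+1) (a k, b k)).2.
have g0 k : a k = 0 -> b k = 0 -> a' k = 0 /\ b' k = 0.
  by rewrite /a' /b' /generator /= => -> ->; rewrite !mulr0 addr0 oppr0.
pose kappa := (sysr d * n.+1)%:Z.
have out0 : a (freq d (d - n.+1)) = 0 /\ b (freq d (d - n.+1)) = 0.
  apply: ab0 => j jm; rewrite mE /freq => E.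
  have : (sysr d * m.+1 = sysr d * j)%N by lia.
  move/eqP; rewrite eqn_pmul2l; last by rewrite /sysr; case: ifP.
  by move/eqP => jE; rewrite -jE ltnn in jm.
exists (prev_coef a a' kappa), (prev_coef b b' kappa); split.
  move=> k kn.
  have [ak bk] : a k = 0 /\ b k = 0 by apply: ab0 => j jm; apply: kn; exact: leqW.
  have [rak rbk] : a (kappa - k) = 0 /\ b (kappa - k) = 0.
    apply: ab0 => j jm E; apply: (kn (m.+1 - j)%N); first exact: leq_subr.
    by rewrite -mE -freq_rev ?mE ?leqW // -E subKr.
  have [ak' bk'] := g0 _ ak bk; have [rak' rbk'] := g0 _ rak rbk.
  by rewrite /prev_coef ak bk rak rbk ak' bk' rak' rbk' conjc0 !mulr0 subrr !mulr0 addr0.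
move=> t z.
have -> : value_at_end d H (A0%:C, B0%:C) n.+1 z =
   (conj_exp_sum d n.+2 a (step_end d n.+1) z, conj_exp_sum d n.+2 b (step_end d n.+1) z).
  rewrite -abE step_endS addrC addKr /value_at_end.
  by rewrite -(subnSK nd1).
rewrite /flow generator_conj_exp_sum /= -/a' -/b'.
have [a0 b0] := out0; have [a'0 b'0] := g0 _ a0 b0.
by rewrite !flow_conj_exp_sum.
Qed.

(** * Zeros and the Hermite-Biehler property *)

Lemma conj_flow_steps (R : realType) (H : nat -> 'M[R]_2) (w : nat -> R[i]) s v :
  conj_pair (flow_steps H w s v) = flow_steps H (fun n => conjc (w n)) s (conj_pair v).
Proof. by elim: s => //= n s <-; rewrite conj_flow. Qed.

Lemma flow_steps_neq0 (R : realType) (H : nat -> 'M[R]_2) (w : nat -> R[i]) s v :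
  {in s, forall n, sym_sl2 (H n)} ->
  v <> (0, 0) -> flow_steps H w s v <> (0, 0).
Proof.
elim: s => //= n s IH Hs v0; have hn := Hs n (mem_head _ _).
by apply: flow_neq0 => //; apply: IH => // m ms; apply: Hs; rewrite in_cons ms orbT.
Qed.

(** The form starts at 0 on a real vector and increases strictly in every step. *)
Lemma wronskian_flow_steps_gt0 (R : realType) (H : nat -> 'M[R]_2) (w : nat -> R[i]) s v :
  {in s, forall n, sym_sl2 (H n)} ->
  {in s, forall n, posdefmx (H n) /\ 0 < complex.Im (w n)} ->
  v <> (0, 0) -> wronskian v = 0 -> (0 < size s)%N -> 0 < wronskian (flow_steps H w s v).
Proof.
elim: s => //= n s IH Hs ws v0 wrv _.
have hn := Hs n (mem_head _ _); have [hp wn] := ws n (mem_head _ _).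
have Hs' : {in s, forall n, sym_sl2 (H n)}.
  by move=> m ms; apply: Hs; rewrite in_cons ms orbT.
apply: wronskian_flow_gt0 => //; first exact: flow_steps_neq0.
case: s IH Hs' {Hs} ws => [|m s] IH Hs' ws; first by rewrite /= wrv.
by apply/ltW/IH => // k ks; apply: ws; rewrite in_cons ks orbT.
Qed.

Lemma entire_flow_steps (R : realType) (H : nat -> 'M[R]_2) (c : nat -> R[i]) s v :
  entire (fun z => (flow_steps H (fun n => z * c n) s v).1) /\
  entire (fun z => (flow_steps H (fun n => z * c n) s v).2).
Proof.
elim: s => [|n s [IH1 IH2]]; first by split; exact: entire_cst.
have eN (f : R[i] -> R[i]) : entire f -> entire (fun z => - f z).
  by move=> ef z; exact: derivableN.
have e1 : entire (fun z => cexp ('i%C * (z * c n))).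
  rewrite (_ : (fun z => _) = (fun z => cexp ('i%C * c n * z))); first exact: entire_cexp.
  by apply/funext => z; congr cexp; ring.
have e2 : entire (fun z => cexp (- ('i%C * (z * c n)))).
  rewrite (_ : (fun z => _) = (fun z => cexp (- ('i%C * c n) * z))); first exact: entire_cexp.
  by apply/funext => z; congr cexp; ring.
have ec : entire (fun z => ccos (z * c n)).
  exact: (entireM (@entire_cst _ (2^-1)%:C) (entireD e1 e2)).
have es : entire (fun z => csin (z * c n)).
  exact: (entireM (@entire_cst _ ((2^-1)%:C * 'i%C)) (entireD e2 (eN _ e1))).
have comb (a b : R) : entire (fun z =>
    a%:C * (flow_steps H (fun n => z * c n) s v).1 +
    b%:C * (flow_steps H (fun n => z * c n) s v).2).
  exact: (entireD (entireM (@entire_cst _ a%:C) IH1) (entireM (@entire_cst _ b%:C) IH2)).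
split; last exact: (entireD (entireM ec IH2) (entireM es (comb _ _))).
exact: (entireD (entireM ec IH1) (entireM es (eN _ (comb _ _)))).
Qed.

(** If [A] and [B] are real then they are the real part and minus the imaginary part
    of [A - i B]. *)
Lemma real_pair_neq0 (R : realType) (v : R[i] * R[i]) :
  conj_pair v = v -> v <> (0, 0) -> v.1 - 'i%C * v.2 <> 0.
Proof.
case: v => -[a b] [e f]; rewrite /conj_pair /= => -[].
move=> b0 f0 v0 /eqP; rewrite eq_complex /= => /andP[/eqP h1 /eqP h2].
apply: v0; have {}b0 : b = 0 by lra.
have {}f0 : f = 0 by lra.
have -> : a = 0 by move: h1; rewrite f0; lra.
have -> : e = 0 by move: h2; rewrite b0; lra.
by rewrite b0 f0.
Qed.

Lemma extend_lim_bounded_lip (R : realType) (L t : R) (f : R -> R[i]) :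
  bounded_lip f -> t <= L -> extend_lim L f t = f t.
Proof.
move=> fb tL; rewrite /extend_lim; case: ltP => // Lt.
have -> : t = L by apply/eqP; rewrite eq_le tL Lt.
apply: cvg_lim; first exact: norm_hausdorff.
exact: bounded_lip_cvg_left.
Qed.

Theorem theorem1p2 (R : realType) (d : nat) (d_gt0 : (0 < d)%N)
    (H : nat -> 'M[R]_2)
    (H_sym : forall n, (1 <= n <= d)%N -> H n \is symmetricmx)
    (H_det : forall n, (1 <= n <= d)%N -> \det (H n) = 1)
    (A0 B0 : R) (AB0_neq0 : (A0, B0) <> (0, 0)) :
  let L : R := (sysL d)%:R in
  let sol := quasi_canonical_solution L (hamiltonian d H) A0 B0 in
  exists A B : R -> R[i] -> R[i],
  let E := fun t z => A t z - 'i%C * B t z in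
  [/\ sol A B,
      (forall A' B' : R -> R[i] -> R[i], sol A' B' ->
        forall (t : R) (z : R[i]), 0 <= t < L -> A' t z = A t z /\ B' t z = B t z),
      (exists a b : nat -> int -> R[i],
        forall (n : nat) (t : R) (z : R[i]), (1 <= n <= d)%N -> in_step d n t ->
        [/\ A t z = exp_sum d n (a n) (fun k => (a n k)^*) t z,
            B t z = exp_sum d n (b n) (fun k => (b n k)^*) t z &
            E t z = exp_sum d n (fun k => a n k - 'i%C * b n k)
                                (fun k => (a n k + 'i%C * b n k)^*) t z]),
      (forall t : R, 0 <= t <= L ->
        extend_lim L (E^~ 0) t = A0%:C - 'i%C * B0%:C /\
        forall x : R, extend_lim L (E^~ x%:C) t <> 0) &
      ((forall n, (1 <= n <= d)%N -> posdefmx (H n)) ->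
        hermite_biehler (E 0))].
Proof.
pose Y0 : R[i] * R[i] := (A0%:C, B0%:C).
pose Y := solution d H Y0.
have Y00 : Y0 <> (0, 0).
  by move=> /(congr1 (fun v => (complex.Re v.1, complex.Re v.2))).
have Y0r : conj_pair Y0 = Y0 by rewrite /conj_pair !conjc_real.
have hH n : n \in iota 1 d -> sym_sl2 (H n).
  by rewrite mem_iota add1n ltnS => nd; apply: sym_sl2_entries; [exact: H_sym|exact: H_det].
have conjY t z : conj_pair (Y t z) = Y t (conjc z).
  rewrite /Y /solution conj_flow_steps Y0r; apply: eq_flow_steps => n _.
  by rewrite conjcM conjc_real.
move=> L sol; exists (fun t z => (Y t z).1), (fun t z => (Y t z).2) => E.
have Y_sol : sol (fun t z => (Y t z).1) (fun t z => (Y t z).2).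
  exact: solution_solves.
have E_lip z : bounded_lip (E^~ z).
  have [b1 b2] := bounded_lip_solution d H Y0 z.
  by apply: bounded_lipD => //; apply: bounded_lipN; apply: bounded_lipM => //; exact: bounded_lip_cst.
have E_neq0 t (x : R) : E t x%:C <> 0.
  apply: real_pair_neq0; first by rewrite conjY conjc_real.
  exact: flow_steps_neq0.
split => //.
- by move=> A' B' sol'; exact: solution_unique sol'.
- have [f fE] : exists f : nat -> (int -> R[i]) * (int -> R[i]), forall n, (n < d)%N ->
      forall t z, flow (H n.+1) (z * (step_end d n.+1 - t)%:C) (value_at_end d H Y0 n.+1 z) =
      (conj_exp_sum d n.+1 (f n).1 t z, conj_exp_sum d n.+1 (f n).2 t z).
    suff /choice[f fE] : forall n, exists ab : (int -> R[i]) * (int -> R[i]),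
      (n < d)%N -> forall t z,
      flow (H n.+1) (z * (step_end d n.+1 - t)%:C) (value_at_end d H Y0 n.+1 z) =
      (conj_exp_sum d n.+1 ab.1 t z, conj_exp_sum d n.+1 ab.2 t z) by exists f.
    move=> n.
    have [nd|dn] := boolP (n < d)%N; last by exists (fun=> 0, fun=> 0).
    by have [a [b [_ abE]]] := step_coefficients H A0 B0 nd; exists (a, b).
  (* Steps are numbered from 1 in the statement and from 0 by [f]. *)
  exists (fun n => (f n.-1).1), (fun n => (f n.-1).2) => -[//|n] t z nd nt.
  have YE : Y t z = (conj_exp_sum d n.+1 (f n).1 t z, conj_exp_sum d n.+1 (f n).2 t z).
    by rewrite -fE // -solution_in_step //; move: nt; rewrite in_stepE => /andP[-> /ltW ->].
  split; [by rewrite YE|by rewrite YE|].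
  rewrite /E YE /= -[conj_exp_sum d n.+1 (f n).1 t z]mul1r -mulNr exp_sum_lin.
  apply: eq_exp_sum => k; first by rewrite mul1r mulNr.
  by rewrite mul1r conjcD conjcM conj_i.
- move=> t /andP[t0 tL]; split; last by move=> x; rewrite extend_lim_bounded_lip.
  rewrite extend_lim_bounded_lip // /E /Y /solution flow_steps_id // => n _; exact: mul0r.
move=> Hpos; split.
- have [e1 e2] := entire_flow_steps H (fun n => (time_left d n 0)%:C) (iota 1 d) Y0.
  move=> z; apply: derivableB; first exact: e1.
  by apply: derivableM; [exact: derivable_cst|exact: e2].
- by move=> x; exact: E_neq0.
move=> z z0.
have sharpE : sharp (E 0) z = (Y 0 z).1 + 'i%C * (Y 0 z).2.
  have := conjY 0 (conjc z); rewrite conjcK => Yz.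
  rewrite /sharp /E conjcD conjcN conjcM conj_i mulNr opprK.
  by rewrite -Yz.
rewrite sharpE cmod_lt -(@ltr_pXn2r _ 2) ?nnegrE ?cmod_ge0 // cmod_sqr_sub_i ltrDl.
rewrite mulr_gt0 //; apply: wronskian_flow_steps_gt0 => //; last by rewrite size_iota.
  move=> [|n]; rewrite mem_iota // add1n ltnS => nd; split; first exact: Hpos.
  rewrite time_left_future; last by rewrite /step_end divr_ge0 ?mulr_ge0.
  case: z z0 {sharpE} => x y /= y0.
  by rewrite mulr0 add0r mulr_gt0 // divr_gt0 // sysr_gt0.
by rewrite /wronskian /=; ring.
Qed.
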